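(* Let $F$ be a non-archimedean local field with ring of integers $\mathcal O$, uniformizer $\pi$ and finite residue field, let $r\ge1$, $\mathcal O_r=\mathcal O/\pi^r\mathcal O$, and let $\mathcal B=\mathcal B_d(F)$. The link of a vertex in the geodesic $r$-power of $\mathcal B$ is isomorphic to $\mathbb P^{d-1}_{\mathrm{fr}}(\mathcal O_r)$. Moreover, for $d\ge3$, the link of a cell of codimension two (a $(d-3)$-cell) in the geodesic $r$-power of $\mathcal B$ is either a complete bipartite graph, or isomorphic to the graph $\mathbb P^2_{\mathrm{fr}}(\mathcal O_r)$.
   Context: The building $\mathcal B_d(F)$ ($d\ge2$) is the $(d-1)$-dimensional clique complex whose vertices are the homothety classes of $\mathcal O$-lattices in $F^d$ (identified with $PGL_d(F)/PGL_d(\mathcal O)$ via $gK\mapsto g\mathcal O^d$), two distinct classes being adjacent iff they have representatives $L,L'$ with $\pi L<L'<L$. Vertices are colored by $\mathrm{col}(gK)=\mathrm{ord}_\pi\det g\in\mathbb Z/d\mathbb Z$, and directed edges by $\mathrm{col}(v\to w)=\mathrm{col}(w)-\mathrm{col}(v)$. For a complex $X$, $X(j)$ denotes its $j$-dimensional cells; the link of a cell $\tau$ is the complex obtained by taking all cells containing $\tau$ and removing $\tau$ from them. An $r$-geodesic (of color one) in $X=\mathcal B$ is a sequence of vertices $v_0,\dots,v_r$ such that $\{v_i,v_{i+1}\}\in X(1)$, $v_{i+2}\neq v_i$, $\{v_i,v_{i+1},v_{i+2}\}\notin X(2)$ and $\mathrm{col}(v_i\to v_{i+1})=1$. The geodesic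 $r$-power of $\mathcal B_d(F)$ has the same vertices; $d$ distinct vertices $v_0,\dots,v_{d-1}$ form a $(d-1)$-cell iff, possibly after reordering, there is an $r$-geodesic from each $v_i$ to $v_{i+1}$ and from $v_{d-1}$ to $v_0$; the lower-dimensional cells are the subsets of these. The free projective $m$-space $\mathbb P^m_{\mathrm{fr}}(\mathcal O_r)$ is the complex whose vertices are the free $\mathcal O_r$-submodules $0<M<\mathcal O_r^{m+1}$ (proper, nonzero), and whose cells are the free flags, i.e. the chains of such free submodules under inclusion. *)

(* Defs.v *)
From HB Require Import structures.
From mathcomp Require Import all_boot all_order all_algebra.
From mathcomp Require Import ring.
From mathcomp Require Import mathcomp_extra boolp classical_sets functions cardinality.

Set Implicit Arguments.
Unset Strict Implicit.
Unset Printing Implicit Defensive.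

Import Order.TTheory GRing.Theory Num.Theory.
Local Open Scope ring_scope.
Local Open Scope classical_set_scope.
Local Open Scope card_scope.

(* [ord] is the normalized valuation; its value at [0] is irrelevant, as
   [ord 0] stands for +oo and [0] is treated apart everywhere below.
   The choice of a uniformizer is part of the data. *)
Record valuation (F : fieldType) := Valuation {
  ord :> F -> int;
  unif : F;
  ordM : forall x y, x != 0 -> y != 0 -> ord (x * y) = ord x + ord y;
  ordD : forall x y, x != 0 -> y != 0 -> x + y != 0 ->
    Num.min (ord x) (ord y) <= ord (x + y);
  unif_neq0 : unif != 0;
  ord_unif : ord unif = 1
}.

Section RingOfIntegers.
Variables (F : fieldType) (V : valuation F).

Definition integral : {pred F} := [pred x | (x == 0) || (0 <= ord V x)].

Lemma ord1 : ord V 1 = 0.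
Proof.
have := ordM V (oner_neq0 F) (oner_neq0 F).
by rewrite mulr1 -{1}[ord V 1]addr0 => /addrI.
Qed.

Lemma ordN x : x != 0 -> ord V (- x) = ord V x.
Proof.
move=> x0; have n1 : -1 != 0 :> F by rewrite oppr_eq0 oner_eq0.
have h : ord V (-1) = 0.
  have := ordM V n1 n1; rewrite mulrNN mulr1 ord1 => /esym/eqP.
  by rewrite -mulr2n mulrn_eq0 /= => /eqP.
by rewrite -mulN1r ordM // h add0r.
Qed.

Lemma integral_subring_closed : subring_closed integral.
Proof.
split=> [|x y|x y]; rewrite !inE.
- by rewrite ord1 lexx orbT.
- have [->|x0] := eqVneq x 0.
    by rewrite sub0r oppr_eq0; have [//|y0] := eqVneq y 0; rewrite ordN.
  have [->|y0] := eqVneq y 0; first by rewrite subr0 (negPf x0).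
  have [//|xy0] := eqVneq (x - y) 0 => /= hx hy.
  have ny0 : - y != 0 by rewrite oppr_eq0.
  by apply: le_trans (ordD V x0 ny0 xy0); rewrite le_min hx ordN.
- have [->|x0] := eqVneq x 0; first by rewrite mul0r eqxx.
  have [->|y0] := eqVneq y 0; first by rewrite mulr0 eqxx.
  by move=> /= hx hy; rewrite ordM // addr_ge0 ?orbT.
Qed.

HB.instance Definition _ :=
  GRing.isSubringClosed.Build F integral integral_subring_closed.

Record integers := Integer { int_val : F; int_valP : int_val \in integral }.

HB.instance Definition _ := [isSub for int_val].
HB.instance Definition _ := [Choice of integers by <:].
HB.instance Definition _ := [SubChoice_isSubComNzRing of integers by <:].

(* The ideal [pi^r O]. For [r = 0] it is not proper and the quotient is not a
   ring in the sense of [comNzRingType], whence the proof argument. *)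
Definition unif_ideal (r : nat) (r_gt0 : (0 < r)%N) : {pred integers} :=
  [pred x | int_val x / unif V ^+ r \in integral].

Lemma unif_ideal_closed r (r_gt0 : (0 < r)%N) :
  idealr_closed (unif_ideal r_gt0).
Proof.
have p0 : unif V ^+ r != 0 by rewrite expf_neq0 ?unif_neq0.
split.
- by rewrite inE /= mul0r rpred0.
- rewrite inE /= mul1r inE negb_or invr_eq0 p0 /= -ltNge.
  have e k : ord V (unif V ^+ k) = k%:Z.
    elim: k => [|k IH]; first by rewrite expr0 ord1.
    by rewrite exprS ordM ?expf_neq0 ?unif_neq0 // IH ord_unif -intS.
  have iv : (unif V ^+ r)^-1 != 0 by rewrite invr_eq0.
  have := ordM V p0 iv; rewrite mulfV // ord1 e => /esym/eqP.
  by rewrite addrC addr_eq0 => /eqP->; rewrite oppr_lt0.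
- move=> a u v hu hv.
  rewrite -[_ \in _]/((int_val a * int_val u + int_val v) / unif V ^+ r
                       \in integral).
  by rewrite mulrDl -mulrA rpredD // rpredM // (valP a).
Qed.

HB.instance Definition _ r (r_gt0 : (0 < r)%N) :=
  isIdealr.Build integers (unif_ideal r_gt0) (unif_ideal_closed r_gt0).

Definition quot_integers (r : nat) (r_gt0 : (0 < r)%N) :=
  {ideal_quot (unif_ideal r_gt0)}.

End RingOfIntegers.

Definition nonarch_local_field (F : fieldType) (V : valuation F) : Prop :=
  (forall u : nat -> F,
     (forall n, exists N, forall i j, (N <= i)%N -> (N <= j)%N ->
        (u i - u j) / unif V ^+ n \in integral V) ->
     exists l, forall n, exists N, forall i, (N <= i)%N ->
        (u i - l) / unif V ^+ n \in integral V) /\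
  finite_set [set: quot_integers V (ltnSn 0)].

(* The vertices of a complex are the [x : T] such that [[set x]] is a cell, so
   the ground type may be larger than the vertex set. The empty cell (of
   dimension -1) is allowed. *)
Record complex (T : Type) := Complex {
  cells :> set T -> Prop;
  cells_finite : forall s, cells s -> finite_set s;
  cells_sub : forall s t, t `<=` s -> cells s -> cells t
}.

Definition vertices T (X : complex T) : set T := [set x | X [set x]].

Definition dim_cells T (X : complex T) (j : nat) : set (set T) :=
  [set s | X s /\ s #= `I_j.+1].

Definition complex_iso T U (X : complex T) (Y : complex U) : Prop :=
  exists f : T -> U, set_bij (vertices X) (vertices Y) f /\
    forall s, s `<=` vertices X -> X s <-> Y (f @` s).

Section Link.
Variables (T : Type) (X : complex T) (tau : set T).

Definition link_cells : set (set T) :=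
  [set s | exists t, [/\ X t, tau `<=` t & s = t `\` tau]].

Lemma link_finite s : link_cells s -> finite_set s.
Proof. by case=> t [/cells_finite ft _ ->]; apply: finite_setD. Qed.

Lemma link_sub s t : t `<=` s -> link_cells s -> link_cells t.
Proof.
move=> ts [s' [Xs' taus' sE]]; exists (t `|` tau); split.
- apply: cells_sub Xs' => x [/ts|/taus' //]; by rewrite sE => -[].
- by move=> x; right.
- rewrite setDUl setDv setU0; apply/seteqP; split=> [x tx|x []//].
  by split=> //; move: (ts _ tx); rewrite sE => -[].
Qed.

Definition link : complex T := Complex link_finite link_sub.
End Link.

Definition complete_bipartite T (X : complex T) : Prop :=
  exists A B : set T,
    [/\ A !=set0, B !=set0, A `&` B = set0 &
      forall s, X s <->
        [\/ s = set0, exists2 a, (A `|` B) a & s = [set a] |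
            exists a b, [/\ A a, B b & s = [set a; b]]]].

Section Building.
Variables (F : fieldType) (V : valuation F) (d : nat).
Implicit Types (L : set 'cV[F]_d) (C D : set (set 'cV[F]_d)).

(* [g O^d] *)
Definition lattice (g : 'M[F]_d) : set 'cV[F]_d :=
  [set g *m x | x in [set x | x \is a mxOver (integral V)]].

Definition is_lattice L := exists2 g, g \in unitmx & L = lattice g.

Definition scale (c : F) L : set 'cV[F]_d := [set c *: x | x in L].

Definition homothety_class L : set (set 'cV[F]_d) :=
  [set scale c L | c in [set c | c != 0]].

Definition building_vertex C :=
  exists2 L, is_lattice L & C = homothety_class L.

(* Symmetric: [pi L < L' < L] gives [pi L' < pi L < L']. *)
Definition adjacent C D :=
  C <> D /\ exists L L', [/\ C L, D L', scale (unif V) L `<` L' & L' `<` L].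

Definition building_cells : set (set (set (set 'cV[F]_d))) :=
  [set s | [/\ finite_set s, s `<=` building_vertex &
     forall C D, s C -> s D -> C <> D -> adjacent C D]].

Lemma building_finite s : building_cells s -> finite_set s.
Proof. by case. Qed.

Lemma building_sub s t : t `<=` s -> building_cells s -> building_cells t.
Proof.
move=> ts [fs vs cs]; split; first exact: sub_finite_set fs.
- by move=> C /ts/vs.
- by move=> C D /ts sC /ts sD; apply: cs.
Qed.

Definition building : complex (set (set 'cV[F]_d)) :=
  Complex building_finite building_sub.

(* The color of [gK], through an arbitrary choice of [g]; see
   [vertex_color_class] for the independence of this choice. For [d <= 1], ['Z_d] is not [Z/dZ]. *)
Definition vertex_color C : 'Z_d :=
  (ord V (\det (xget 1%:M
    [set g | g \in unitmx /\ C = homothety_class (lattice g)])))%:~R.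

Definition edge_color C D : 'Z_d := vertex_color D - vertex_color C.

Section Geodesics.
Variable r : nat.

(* There is an [r]-geodesic (of color one) from [C] to [D]; only the values
   [v 0, ..., v r] matter. *)
Definition geodesic C D :=
  exists v : nat -> set (set 'cV[F]_d),
    [/\ v 0%N = C, v r = D,
      forall i, (i < r)%N -> dim_cells building 1 [set v i; v i.+1] /\
                             edge_color (v i) (v i.+1) = 1 &
      forall i, (i.+1 < r)%N -> v i.+2 <> v i /\
                  ~ dim_cells building 2 [set v i; v i.+1; v i.+2]].

Definition power_top_cell (s : set (set (set 'cV[F]_d))) :=
  exists v : 'I_d -> set (set 'cV[F]_d),
    [/\ injective v, forall i, building_vertex (v i),
        forall i, geodesic (v i) (v (ordS i)) & s = range v].

Definition power_cells : set (set (set (set 'cV[F]_d))) :=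
  [set s | (exists2 C, building_vertex C & s `<=` [set C]) \/
           (exists2 t, power_top_cell t & s `<=` t)].

Lemma power_finite s : power_cells s -> finite_set s.
Proof.
case=> [[C _ /sub_finite_set]|[t [v [_ _ _ ->]] /sub_finite_set]]; apply.
- exact: finite_set1.
- exact: finite_image.
Qed.

Lemma power_sub s t : t `<=` s -> power_cells s -> power_cells t.
Proof.
move=> ts [[C vC sC]|[u uP su]]; [left; exists C|right; exists u] => //.
- exact: subset_trans sC.
- exact: subset_trans su.
Qed.

Definition geodesic_power : complex (set (set 'cV[F]_d)) :=
  Complex power_finite power_sub.

End Geodesics.

Lemma ord_expr c n : c != 0 -> ord V (c ^+ n) = ord V c *+ n.
Proof.
move=> c0; elim: n => [|n IH]; first by rewrite expr0 ord1 mulr0n.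
by rewrite exprS ordM ?expf_neq0 // IH mulrS.
Qed.

Lemma lattice_col g j : lattice g (col j g).
Proof.
exists (delta_mx j 0); last by rewrite colE.
by apply/mxOverP=> a b; rewrite mxE; case: (_ && _); rewrite ?rpred1 ?rpred0.
Qed.

Lemma lattice_sub_scale c g h : c != 0 -> g \in unitmx -> h \in unitmx ->
  lattice g `<=` scale c (lattice h) ->
  c^-1 *: (invmx h *m g) \is a mxOver (integral V).
Proof.
move=> c0 gu hu sub; apply/mxOverP => i j.
have [_ [x xO <-] e] := sub _ (lattice_col g j).
suff -> : (c^-1 *: (invmx h *m g)) i j = x i 0 by exact: (mxOverP xO).
have -> : x = c^-1 *: (invmx h *m col j g).
  by rewrite -e -scalemxAr mulKmx // scalerA mulVf // scale1r.
by rewrite colE mulmxA -colE !mxE.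
Qed.

Lemma mxOver_det (k : 'M[F]_d) :
  k \is a mxOver (integral V) -> \det k \in integral V.
Proof.
move=> /mxOverP kO; apply: rpred_sum => s _.
by rewrite rpredM ?rpredX ?rpredN1 // rpred_prod.
Qed.

Lemma vertex_color_class g : (1 < d)%N -> g \in unitmx ->
  vertex_color (homothety_class (lattice g)) = (ord V (\det g))%:~R.
Proof.
move=> d1 gu; rewrite /vertex_color.
set P := (X in xget _ X).
have [hu] : P (xget 1%:M P) by apply: (@xgetI _ _ P g).
move: (xget _ _) hu => h hu e.
have : homothety_class (lattice h) (lattice g).
  rewrite -e; exists 1; first exact: oner_neq0.
  rewrite /scale; apply/seteqP; split=> [_ [x ? <-]|x ?].
  - by rewrite scale1r.
  - by exists x; rewrite ?scale1r.
case=> c /= c0 E.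
have s1 : lattice g `<=` scale c (lattice h) by rewrite E.
have s2 : lattice h `<=` scale c^-1 (lattice g).
  move=> x hx; exists (c *: x); last by rewrite scalerA mulVf // scale1r.
  by rewrite -E; exists x.
have kO := mxOver_det (lattice_sub_scale c0 gu hu s1).
have lO := mxOver_det (lattice_sub_scale (invr_neq0 c0) hu gu s2).
have dg : \det g != 0 by rewrite -unitfE -unitmxE.
have dh : \det h != 0 by rewrite -unitfE -unitmxE.
move: kO lO; rewrite !detZ !det_mulmx !det_inv invrK.
set q := _ * _ => kO; have q0 : q != 0.
  by rewrite !mulf_neq0 ?expf_neq0 ?invr_eq0.
have -> : c ^+ d * ((\det g)^-1 * \det h) = q^-1.
  by rewrite /q exprVn !invfM !invrK [\det h / _]mulrC.
have oqV : ord V q^-1 = - ord V q.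
  apply/eqP; rewrite -addr_eq0 -ordM ?invr_eq0 // mulVf // ord1 eqxx //.
move: kO; rewrite !inE invr_eq0 (negPf q0) /= oqV oppr_ge0 => qge qle.
have oq : ord V q = 0 by apply/eqP; rewrite eq_le qge qle.
have -> : \det g = c ^+ d * \det h * q.
  by rewrite /q exprVn; field; rewrite dh expf_neq0.
clearbody q; rewrite ordM ?mulf_neq0 ?expf_neq0 // oq addr0.
rewrite ordM ?expf_neq0 // ord_expr // intrD.
rewrite -[_ *+ d]mulr_natr intrM.
have -> : (d%:R : int)%:~R = 0 :> 'Z_d by rewrite natz -pmulrn pchar_Zp.
by rewrite mulr0 add0r.
Qed.

End Building.

Section FreeProjective.
Variables (m : nat) (R : comNzRingType).
Implicit Types (M N : set 'cV[R]_m.+1).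

(* The span of a basis given by the columns of [B] *)
Definition free_submodule M :=
  exists k (B : 'M[R]_(m.+1, k)),
    injective (fun u : 'cV[R]_k => B *m u) /\
    M = range (fun u : 'cV[R]_k => B *m u).

Definition proj_free_vertex M :=
  [/\ free_submodule M, [set 0] `<` M & M `<` setT].

Definition proj_free_cells : set (set (set 'cV[R]_m.+1)) :=
  [set s | [/\ finite_set s, s `<=` proj_free_vertex &
     forall M N, s M -> s N -> M `<=` N \/ N `<=` M]].

Lemma proj_free_finite s : proj_free_cells s -> finite_set s.
Proof. by case. Qed.

Lemma proj_free_sub s t : t `<=` s -> proj_free_cells s -> proj_free_cells t.
Proof.
move=> ts [fs vs cs]; split; first exact: sub_finite_set fs.
- by move=> M /ts/vs.
- by move=> M N /ts sM /ts sN; apply: cs.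
Qed.

Definition proj_free : complex (set 'cV[R]_m.+1) :=
  Complex proj_free_finite proj_free_sub.

End FreeProjective.

(* Main.v *)
(** Fix a vertex C = [L]. A color-one path of r edges starting at L is a chain of
    sublattices, each maximal in the previous one; that three consecutive ones
    neither backtrack nor span a triangle means that the chain is uniserial, so
    that an r-geodesic leads from [L] to [L'] exactly when L' < L can be chosen
    with L / L' isomorphic to O_r. A top cell through C is thus a chain
    L = L_0 > L_1 > ... > L_d = pi^r L with quotients O_r, i.e. the image of a
    full free flag of L / pi^r L = O_r^d. Since every nonunit of O_r is killed by
    pi^(r-1), an injective matrix over O_r can be completed to an invertible one,
    and every free flag is part of a full one, spanned by the initial columns of
    an invertible matrix. This identifies the link of C with the free projective
    space. A cell of codimension two through C lacks two ranks a < b of a full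
    flag; if b > a + 1 the two missing modules can be chosen independently, and
    if b = a + 1 they form a free flag of a subquotient isomorphic to O_r^3. *)

Require Import Defs.
From mathcomp Require Import all_boot all_order all_algebra.
From mathcomp Require Import perm generic_quotient ring_quotient ring zify.
From mathcomp Require Import boolp classical_sets functions cardinality.

Set Implicit Arguments.
Unset Strict Implicit.
Unset Printing Implicit Defensive.

Import Order.TTheory GRing.Theory Num.Theory.

(** * Spans of initial columns *)

Section ColumnSpans.
Local Open Scope ring_scope.
Local Open Scope classical_set_scope.
Variable A : comNzRingType.

(** A free flag is encoded by one invertible square matrix [k] together with ranks, the module of
    rank [i] being [col_span k i], so that a change of flag is a matrix product. Completion of
    bases, invariance of the rank and refinement of flags all come from [injective_completion],
    whose only input is a nonzero [t] killing every nonunit. The links are computed for any complex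
    satisfying [v_eq], [v0] and [star]; the building enters through [chart_eq], [chart0] and
    [vertex_star]. The obstacle there is that vertices are homothety classes whereas flags consist
    of modules. Two normalizations deal with it: along an edge the valuations of determinants are
    confined to a range in which the color modulo [d] determines them, and a free module of positive
    rank contains a vector that is nonzero modulo [pi], which leaves no room for scaling.
    Conversely, geodesics are written down in a basis of the lattice that lifts the columns of [k];
    they descend, so the ranks in a top cell run backwards. *)

Definition invertible n (k : 'M[A]_n) := exists k', k *m k' = 1%:M.

Lemma invertible1 n : invertible (1%:M : 'M_n).
Proof. by exists 1%:M; rewrite mulmx1. Qed.

Lemma invertibleM n (k l : 'M_n) :
  invertible k -> invertible l -> invertible (k *m l).
Proof.
move=> [k' kk'] [l' ll']; exists (l' *m k').
by rewrite mulmxA -(mulmxA k) ll' mulmx1.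
Qed.

Definition std_span n i : set 'cV[A]_n :=
  [set x | forall p : 'I_n, (i <= p)%N -> x p 0 = 0].

Definition col_span n (k : 'M[A]_n) i : set 'cV[A]_n :=
  [set k *m x | x in std_span i].

Lemma std_span_le n i j : (i <= j)%N ->
  @std_span n i `<=` @std_span n j.
Proof. by move=> ij x xi p /(leq_trans ij)/xi. Qed.

Lemma col_span_le n (k : 'M_n) i j : (i <= j)%N ->
  col_span k i `<=` col_span k j.
Proof. by move=> ij; apply: image_subset; exact: std_span_le. Qed.

Lemma std_span_delta n i (q : 'I_n) : (q < i)%N ->
  @std_span n i (delta_mx q 0).
Proof.
move=> qi p ip; rewrite mxE andbT; case: eqP => // pq.
by rewrite -pq ltnNge ip in qi.
Qed.

Lemma col_spanM n (k l : 'M_n) i :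
  col_span (k *m l) i = [set k *m x | x in col_span l i].
Proof.
rewrite /col_span image_comp; apply: eq_imagel => x _ /=.
by rewrite mulmxA.
Qed.

Lemma col_span1 n i : col_span 1%:M i = @std_span n i.
Proof. by rewrite /col_span; apply: eq_image_id => x _; rewrite mul1mx. Qed.

Lemma col_spanMS n (k l l' : 'M_n) i j : invertible k ->
  col_span (k *m l) i `<=` col_span (k *m l') j <->
  col_span l i `<=` col_span l' j.
Proof.
move=> [k' kk']; rewrite !col_spanM; split=> [S|]; last exact: image_subset.
have k'k := mulmx1C kk'; move=> x lx.
have [|y ly e] := S (k *m x); first by exists x.
by rewrite -[x]mul1mx -k'k -mulmxA -e mulmxA k'k mul1mx.
Qed.

Lemma col_spanMI n (k l l' : 'M_n) i j : invertible k ->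
  col_span (k *m l) i = col_span (k *m l') j <-> col_span l i = col_span l' j.
Proof.
by move=> kI; split=> e; apply/seteqP; split; apply/(col_spanMS _ _ _ _ kI);
  rewrite e.
Qed.

Lemma std_span_sum n i (k : 'M[A]_n) (x : 'cV_n) : std_span i x ->
  k *m x = \sum_(q < n | (q < i)%N) x q 0 *: col q k.
Proof.
move=> xi; apply/matrixP=> p j; rewrite ord1 mxE summxE [RHS]big_mkcond.
apply: eq_bigr => q _; case: ltnP => [qi|iq].
  by rewrite !mxE mulrC.
by rewrite xi // mulr0.
Qed.

Lemma eq_col_span n (k l : 'M_n) i :
  (forall q : 'I_n, (q < i)%N -> col q k = col q l) ->
  col_span k i = col_span l i.
Proof.
move=> kl; apply: eq_imagel => x xi; rewrite !(std_span_sum _ xi).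
by apply: eq_bigr => q qi; rewrite kl.
Qed.

Lemma std_spanP n i (h : 'M[A]_n) j :
  col_span h j `<=` std_span i <->
  forall p q : 'I_n, (i <= p)%N -> (q < j)%N -> h p q = 0.
Proof.
split=> [S p q ip qj|H _ [x xj <-] p ip].
  have : std_span i (h *m delta_mx q 0).
    by apply: S; exists (delta_mx q 0) => //; apply: std_span_delta.
  by rewrite -colE => /(_ p ip); rewrite mxE.
rewrite mxE big1 // => q _; have [qj|jq] := ltnP q j.
  by rewrite H // mul0r.
by rewrite xj // mulr0.
Qed.

Lemma std_span_full n i : (n <= i)%N -> @std_span n i = setT.
Proof.
move=> ni; apply/seteqP; split=> // x _ p ip.
by have := ltn_ord p; rewrite ltnNge (leq_trans ni ip).
Qed.

Lemma std_span0 n : @std_span n 0 = [set 0].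
Proof.
apply/seteqP; split=> [x x0|_ -> p _]; last by rewrite mxE.
by apply/matrixP => p j; rewrite ord1 x0 // mxE.
Qed.

Lemma col_span_full n (k : 'M_n) i : invertible k -> (n <= i)%N ->
  col_span k i = setT.
Proof.
move=> [k' kk'] ni; apply/seteqP; split=> // x _.
exists (k' *m x); first by rewrite std_span_full.
by rewrite mulmxA kk' mul1mx.
Qed.

Lemma col_span0 n (k : 'M_n) : col_span k 0 = [set 0].
Proof. by rewrite /col_span std_span0 image_set1 mulmx0. Qed.

(** * Diagonal blocks of a matrix *)

Section Window.
Variables (n l lo : nat) (le_n : (lo + l <= n)%N).

Lemma window_ord_lt (p : 'I_l) : (lo + p < n)%N.
Proof. by apply: leq_trans le_n; rewrite ltn_add2l. Qed.

Definition window_ord (p : 'I_l) : 'I_n := Ordinal (window_ord_lt p).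

Definition in_window (p : nat) := (lo <= p < lo + l)%N.

Definition window (h : 'M[A]_n) : 'M[A]_l :=
  \matrix_(p, q) h (window_ord p) (window_ord q).

(** A block at offset [lo] inside the identity. The partial inverse of [window_ord] given by [pick]
    avoids splitting [n] as a sum of three block sizes. *)
Definition window_ext (m : 'M[A]_l) : 'M[A]_n :=
  \matrix_(p, q) oapp (fun p' => oapp (fun q' => m p' q') (p == q)%:R
    [pick q' | window_ord q' == q]) (p == q)%:R [pick p' | window_ord p' == p].

Lemma window_ord_inj : injective window_ord.
Proof. by move=> p q /(congr1 val)/addnI/val_inj. Qed.

Lemma in_windowP (p : 'I_n) : reflect (exists q, p = window_ord q) (in_window p).
Proof.
apply: (iffP andP) => [[h1 h2]|[q ->]]; last by rewrite /= leq_addr ltn_add2l.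
have pl : (p - lo < l)%N by rewrite ltn_subLR.
by exists (Ordinal pl); apply: val_inj; rewrite /= subnKC.
Qed.

Lemma pick_window p : [pick p' | window_ord p' == window_ord p] = Some p.
Proof.
case: pickP => [q /eqP/window_ord_inj->//|/(_ p)]; by rewrite eqxx.
Qed.

Lemma pick_nwindow (p : 'I_n) : ~~ in_window p ->
  [pick p' | window_ord p' == p] = None.
Proof.
move=> /in_windowP np; case: pickP => // q /eqP e; case: np.
by exists q.
Qed.

Lemma window_extE m p q :
  window_ext m (window_ord p) (window_ord q) = m p q.
Proof. by rewrite mxE !pick_window. Qed.

Lemma window_ext_out m (p q : 'I_n) : ~~ (in_window p && in_window q) ->
  window_ext m p q = (p == q)%:R.
Proof.
rewrite mxE negb_and; case/orP => /pick_nwindow -> //.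
by case: pickP.
Qed.

Lemma window_extK m : window (window_ext m) = m.
Proof. by apply/matrixP => p q; rewrite mxE window_extE. Qed.

Lemma window_ext1 : window_ext 1%:M = 1%:M.
Proof.
apply/matrixP=> p q.
have [/andP[/in_windowP[p' ->] /in_windowP[q' ->]]|out] :=
  boolP (in_window p && in_window q).
  by rewrite window_extE !mxE (inj_eq window_ord_inj).
by rewrite window_ext_out // mxE.
Qed.

Lemma sum_window (G : 'I_n -> A) :
  (forall q : 'I_n, ~~ in_window q -> G q = 0) ->
  \sum_q G q = \sum_(q < l) G (window_ord q).
Proof.
move=> G0; rewrite (bigID (fun q : 'I_n => in_window q)) /=.
rewrite [X in _ + X]big1 ?addr0 //.
rewrite (reindex_omap window_ord (fun q => [pick q' | window_ord q' == q])) /=.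
  by apply: eq_bigl => q; rewrite pick_window eqxx andbT /= /in_window leq_addr
    ltn_add2l ltn_ord.
by move=> _ /in_windowP[q ->]; rewrite pick_window.
Qed.

Lemma window_extM m m' :
  window_ext m *m window_ext m' = window_ext (m *m m').
Proof.
apply/matrixP=> p q; rewrite mxE.
have [inp|outp] := boolP (in_window p); last first.
  rewrite window_ext_out ?(negPf outp) // (bigD1 p) //= big1 => [|s sp].
    by rewrite addr0 !window_ext_out ?(negPf outp) // eqxx mul1r.
  by rewrite window_ext_out ?(negPf outp) // eq_sym (negPf sp) mul0r.
have [inq|outq] := boolP (in_window q); last first.
  rewrite window_ext_out ?(negPf outq) ?andbF // (bigD1 q) //= big1 => [|s sp].
    by rewrite addr0 !window_ext_out ?(negPf outq) ?andbF // eqxx mulr1.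
  by rewrite (@window_ext_out m' s) ?(negPf outq) ?andbF // (negPf sp) mulr0.
rewrite sum_window => [|s outs].
  case/in_windowP: inp => p' ->; case/in_windowP: inq => q' ->.
  by rewrite window_extE mxE; apply: eq_bigr => s _; rewrite !window_extE.
rewrite window_ext_out ?(negPf outs) ?andbF //.
case: eqP => [e|]; last by rewrite mul0r.
by move: outs; rewrite -e inp.
Qed.

Lemma window_ext_invertible m : invertible m -> invertible (window_ext m).
Proof.
by case=> m' mm'; exists (window_ext m'); rewrite window_extM mm' window_ext1.
Qed.

(** Unless [j] falls strictly inside the window, no entry of the block lies in a row from [j] on and
    a column below [j]. The inverse block gives the other inclusion. *)
Lemma window_ext_std m j : invertible m -> ~~ (lo < j < lo + l)%N ->
  col_span (window_ext m) j = std_span j.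
Proof.
move=> [m' mm'] jout.
have sub w : col_span (window_ext w) j `<=` std_span j.
  apply/std_spanP => p q jp qj; rewrite window_ext_out.
    by case: eqP => // pq; rewrite -pq ltnNge jp in qj.
  apply: contra jout => /andP[/andP[_ pl] /andP[lq _]].
  by rewrite (leq_ltn_trans lq qj) (leq_ltn_trans jp pl).
apply/seteqP; split=> // x jx; exists (window_ext m' *m x).
  by apply: (sub m'); exists x.
by rewrite mulmxA window_extM mm' window_ext1 mul1mx.
Qed.

(** The diagonal block is the action on a subquotient of the standard flag: a summation index below
    the window is killed by [h], one above it by [h']. *)
Lemma windowM (h h' : 'M[A]_n) :
  col_span h lo `<=` std_span lo ->
  col_span h' (lo + l) `<=` std_span (lo + l) ->
  window (h *m h') = window h *m window h'.
Proof.
move=> /std_spanP h0 /std_spanP h'0; apply/matrixP => p q.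
rewrite !mxE sum_window => [|s outs].
  by apply: eq_bigr => s _; rewrite !mxE.
have [slo|los] := ltnP s lo; first by rewrite h0 ?mul0r //= leq_addr.
rewrite [h' _ _]h'0 ?mulr0 //=; last by rewrite ltn_add2l.
by rewrite leqNgt; move: outs; rewrite /in_window los.
Qed.

End Window.

Lemma window1 n l lo (le_n : (lo + l <= n)%N) : window le_n 1%:M = 1%:M.
Proof. by rewrite -(window_ext1 le_n) window_extK. Qed.

End ColumnSpans.

(** * Free flags *)

Section FreeFlags.
Local Open Scope ring_scope.
Local Open Scope classical_set_scope.
Variable A : comNzRingType.

Section Socle.
(* For [A = O_r], take [t = pi^(r-1)]. *)
Variable t : A.
Hypotheses (t_neq0 : t != 0)
  (socle : forall a : A, (exists b, a * b = 1) \/ t * a = 0).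

(** Gaussian elimination: if the first column had no unit entry, [t] times the first basis vector
    would lie in the kernel. A unit entry serves as pivot, and the Schur complement [D] is injective
    with one column less. *)
Lemma injective_completion m n (C : 'M[A]_(m, n)) :
  (forall x : 'cV_n, C *m x = 0 -> x = 0) ->
  (n <= m)%N /\ exists2 k, invertible k & C = k *m pid_mx n.
Proof.
elim: n m C => [|n IH] m C Cinj.
  by split=> //; exists 1%:M; [exact: invertible1|rewrite !thinmx0].
have [p [b bE]] : exists p b, C p 0 * b = 1.
  apply: contrapT => H.
  have tC p : t * C p 0 = 0.
    by case: (socle (C p 0)) => // -[b bE]; case: H; exists p, b.
  have e0 : C *m (t *: delta_mx 0 0 : 'cV_n.+1) = 0.
    rewrite -scalemxAr -colE; apply/matrixP=> p j.
    by rewrite !mxE tC.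
  have /matrixP/(_ 0 0) := Cinj _ e0; rewrite !mxE !eqxx mulr1 => /eqP.
  by rewrite (negPf t_neq0).
case: m => [|m] in C Cinj p bE *; first by case: p bE.
pose s : 'M[A]_m.+1 := tperm_mx 0 p.
have ss : s *m s = 1%:M by rewrite -perm_mxM tperm2 perm_mx1.
pose C' : 'M_(1 + m, 1 + n) := row_perm (tperm 0 p) C.
have sC : C = s *m C' by rewrite -row_permE /C' -row_permM tperm2 row_perm1.
pose u := ulsubmx C'; pose a := ursubmx C'; pose c := dlsubmx C'.
have uE : u = (C p 0)%:M.
  apply/matrixP=> i j; rewrite !ord1 !mxE /= mulr1n.
  congr (C _ _); last exact: val_inj.
  by rewrite (_ : lshift m 0 = 0) ?tpermL //; apply: val_inj.
pose w : 'M[A]_1 := b%:M.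
have uw : u *m w = 1%:M by rewrite uE -scalar_mxM bE.
have wu := mulmx1C uw.
pose D := drsubmx C' - c *m w *m a.
have C'E : C' = block_mx 1%:M 0 (c *m w) 1%:M *m block_mx u a 0 D.
  rewrite mulmx_block !mul1mx !mul0mx !addr0 -mulmxA wu mulmx1.
  by rewrite /D addrC -[_ - _ + _]addrA addNr addr0 submxK.
have [|nm [k' k'I DE]] := IH _ D.
  move=> y Dy.
  (* The upper coordinate cancels [a *m y], which lifts a kernel vector of [D] to one of [C]. *)
  pose z : 'cV_(1 + n) := col_mx (- (w *m (a *m y))) y.
  have z0 : block_mx u a 0 D *m z = 0.
    rewrite mul_block_col Dy mul0mx addr0 mulmxN !mulmxA uw mul1mx.
    by rewrite addNr col_mx0.
  have /eqP : z = 0 by apply: Cinj; rewrite sC C'E -!mulmxA z0 !mulmx0.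
  by rewrite col_mx_eq0 => /andP[_ /eqP].
(* [x] is [a] padded with zero columns to width [m]; the truncation by [pid_mx n.+1] recovers
   [a]. *)
split=> //; pose x := a *m (pid_mx n : 'M_(n, m)).
pose P1 : 'M_(1 + m) := block_mx 1%:M 0 (c *m w) 1%:M.
pose P2 : 'M_(1 + m) := block_mx 1%:M 0 0 k'.
pose P3 : 'M_(1 + m) := block_mx u x 0 1%:M.
have P1I : invertible P1.
  exists (block_mx 1%:M 0 (- (c *m w)) 1%:M).
  by rewrite mulmx_block !mul1mx !mul0mx !mulmx0 !mulmx1 !addr0 add0r addrN
    -scalar_mx_block.
have P2I : invertible P2.
  case: k'I => k'' kk; exists (block_mx 1%:M 0 0 k'').
  by rewrite mulmx_block !mul1mx !mul0mx !mulmx0 kk !addr0 add0r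
    -scalar_mx_block.
have P3I : invertible P3.
  exists (block_mx w (- (w *m x)) 0 1%:M).
  by rewrite mulmx_block !mul1mx !mul0mx !mulmx0 !mulmx1 mulmxN mulmxA uw mul1mx
    !addr0 add0r addNr -scalar_mx_block.
exists (s *m (P1 *m (P2 *m P3))).
  by apply: invertibleM; [exists s|do 2!apply: invertibleM => //].
have pE : pid_mx n.+1 = block_mx 1%:M 0 0 (pid_mx n) :> 'M[A]_(1 + m, 1 + n).
  apply/matrixP=> i j; rewrite !mxE.
  case: split_ordP => i' ->; rewrite !mxE; case: split_ordP => j' ->;
    by rewrite !mxE ?ord1.
have P23 : P2 *m P3 *m pid_mx n.+1 = block_mx u a 0 D.
  rewrite pE !mulmx_block !mul1mx !mul0mx !mulmx0 !mulmx1 !addr0 !add0r DE.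
  by rewrite /x -mulmxA pid_mx_id // pid_mx_1 mulmx1.
by rewrite sC C'E -!mulmxA; congr (_ *m (_ *m _)); rewrite mulmxA P23.
Qed.

(* A basis of the larger module is changed so as to extend the one of the smaller
   module, by completing the matrix expressing the latter in the former. *)
Lemma col_span_refine n (k0 k : 'M[A]_n) i j : (i <= n)%N -> (j <= n)%N ->
  invertible k0 -> invertible k -> col_span k0 j `<=` col_span k i ->
  (j <= i)%N /\ exists k1, [/\ invertible k1, col_span k1 i = col_span k i &
    forall l, (l <= j)%N -> col_span k1 l = col_span k0 l].
Proof.
move=> i_n j_n [k0' k00'] kI S; case: (kI) => k' kk'.
pose h := k' *m k0; have k0E : k0 = k *m h by rewrite mulmxA kk' mul1mx.
clearbody h.
have /std_spanP h0 : col_span h j `<=` std_span i.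
  by rewrite -col_span1; apply/(col_spanMS _ _ _ _ kI); rewrite -k0E mulmx1.
have hI : (k0' *m k) *m h = 1%:M by rewrite -mulmxA -k0E (mulmx1C k00').
have [jn0 in0] : (0 + j <= n)%N /\ (0 + i <= n)%N by [].
pose C : 'M_(i, j) := \matrix_(p, q) h (window_ord in0 p) (window_ord jn0 q).
have [|ji [m mI CE]] := @injective_completion i j C.
  move=> x Cx.
  pose y : 'cV[A]_n := \col_q oapp (x ^~ 0) 0 [pick q' | window_ord jn0 q' == q].
  have yE q : y (window_ord jn0 q) 0 = x q 0 by rewrite mxE pick_window.
  have yout (q : 'I_n) : ~~ in_window j 0 q -> y q 0 = 0.
    by move=> qout; rewrite mxE pick_nwindow.
  have hy : h *m y = 0.
    apply/matrixP=> p z; rewrite ord1 [RHS]mxE mxE.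
    rewrite (sum_window jn0) => [|q /yout->]; last by rewrite mulr0.
    have [pi|ip] := ltnP p i; last first.
      by rewrite big1 // => q _; rewrite h0 ?mul0r //; exact: (ltn_ord q).
    transitivity ((C *m x) (Ordinal pi) 0); last by rewrite Cx mxE.
    rewrite mxE; apply: eq_bigr => q _; rewrite yE mxE; congr (h _ _ * _).
    exact: val_inj.
  have y0 : y = 0 by rewrite -[y]mul1mx -hI -mulmxA hy mulmx0.
  by apply/matrixP=> q z; rewrite ord1 -yE y0 !mxE.
(* [m] mixes only the first [i] columns of [k], so their span is kept, and [C = m *m pid_mx j] makes
   the first [j] of them those of [k0]. *)
split=> //; exists (k *m window_ext in0 m); split.
- by apply: invertibleM => //; apply: window_ext_invertible.
- rewrite -[X in _ = col_span X _]mulmx1; apply/(col_spanMI _ _ _ _ kI).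
  by rewrite col_span1 window_ext_std // add0n ltnn andbF.
- move=> l lj; apply: eq_col_span => q ql.
  have qj := leq_trans ql lj; have qi := leq_trans qj ji.
  rewrite k0E !colE -!mulmxA -!colE; congr (_ *m _).
  apply/matrixP=> p z; rewrite mxE [RHS]mxE.
  have [pi|ip] := ltnP p i; last first.
    rewrite h0 // window_ext_out; last by rewrite /in_window /= ltnNge ip.
    by case: eqP => // pq; rewrite -pq ltnNge ip in qi.
  have pE : p = window_ord in0 (Ordinal pi) by apply: val_inj.
  transitivity (C (Ordinal pi) (Ordinal qj)).
    have {1}-> : q = window_ord in0 (Ordinal qi) by apply: val_inj.
    rewrite {1}pE window_extE CE mxE (bigD1 (Ordinal qi)) //= big1 => [|s sq].
      by rewrite mxE eqxx qj mulr1 addr0.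
    rewrite mxE (_ : (s == q :> nat) = false) ?mulr0 //.
    by apply: contraNF sq => /eqP e; apply/eqP/val_inj.
  by rewrite mxE -pE; congr (h p _); apply: val_inj.
Qed.

Lemma col_span_rank n (k k' : 'M[A]_n) i j : (i <= n)%N -> (j <= n)%N ->
  invertible k -> invertible k' -> col_span k i = col_span k' j -> i = j.
Proof.
move=> i_n j_n kI k'I e; apply/eqP; rewrite eqn_leq.
have [] := @col_span_refine _ k k' j i; rewrite ?e // => -> _.
by have [] := @col_span_refine _ k' k i j; rewrite ?e.
Qed.

(** Refinement gives a basis [k1] whose first [i] columns span both modules. *)
Lemma col_span_eq_rank n (k k' : 'M[A]_n) i : (i <= n)%N ->
  invertible k -> invertible k' -> col_span k i `<=` col_span k' i ->
  col_span k i = col_span k' i.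
Proof.
move=> i_n kI k'I S; have [_ [k1 [_ <- e]]] := col_span_refine i_n i_n kI k'I S.
by rewrite e.
Qed.

(** Strong induction on the rank of an ambient module: among the members inside it of smaller rank,
    one of maximal rank contains all the others. A basis adapted to the part of the flag below that
    member is extended by [col_span_refine]. *)
Lemma flag_extension n (s : set (set 'cV[A]_n)) :
  (forall N, s N -> exists k i, [/\ invertible k, (i <= n)%N & N = col_span k i]) ->
  (forall M N, s M -> s N -> M `<=` N \/ N `<=` M) ->
  exists2 k, invertible k &
    forall N, s N -> exists2 i, (i <= n)%N & N = col_span k i.
Proof.
move=> sfree schain.
suff H i (k : 'M[A]_n) : (i <= n)%N -> invertible k ->
    exists k1, [/\ invertible k1, col_span k1 i = col_span k i &
      forall N, s N -> N `<=` col_span k i ->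
        exists2 l, (l <= i)%N & N = col_span k1 l].
  have [k1 [k1I _ k1P]] := H n 1%:M (leqnn n) (invertible1 A n).
  exists k1 => // N /k1P; apply.
  by rewrite col_span_full //; exact: invertible1.
elim/ltn_ind: i k => i IH k i_n kI.
pose below j := `[< exists k', [/\ (j < i)%N, invertible k', s (col_span k' j) &
  col_span k' j `<=` col_span k i] >].
have [ex|none] := pselect (exists j, below j); last first.
  exists k; split=> // N sN NM; have [k' [l [k'I l_n NE]]] := sfree _ sN.
  rewrite NE in sN NM *; exists i => //.
  have [li _] := col_span_refine i_n l_n k'I kI NM.
  have [lt_li|le_il] := ltnP l i.
    by case: none; exists l; apply/asboolP; exists k'.
  have ei : l = i by apply/eqP; rewrite eqn_leq li.
  by subst l; apply: col_span_eq_rank.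
have ub j : below j -> (j <= i)%N by move=> /asboolP[k' [/ltnW]].
have [j /asboolP[k' [ji k'I sk' Nk']] jmax] := ex_maxnP ex ub.
have j_n := leq_trans (ltnW ji) i_n.
have [k0 [k0I k0E k0P]] := IH j ji k' j_n k'I.
rewrite -k0E in Nk'.
have [_ [k1 [k1I k1E k1P]]] := col_span_refine i_n j_n k0I kI Nk'.
exists k1; split=> // N sN NM; have [k2 [l [k2I l_n NE]]] := sfree _ sN.
have NM' := NM; rewrite NE in NM'.
have [li _] := col_span_refine i_n l_n k2I kI NM'.
have [lt_li|le_il] := ltnP l i; last first.
  have ei : l = i by apply/eqP; rewrite eqn_leq li.
  by subst l; exists i => //; rewrite k1E NE; apply: col_span_eq_rank.
have lj : (l <= j)%N by apply: jmax; apply/asboolP; exists k2; split; rewrite -?NE.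
have [/k0P[//|l' l'j ->]|S] := schain _ _ sN sk'.
  by exists l'; rewrite ?k1P // (leq_trans l'j (ltnW ji)).
exists j; rewrite ?(ltnW ji) // k1P // k0E NE.
rewrite NE in S; have [jl _] := col_span_refine l_n j_n k'I k2I S.
have ej : l = j by apply/eqP; rewrite eqn_leq lj.
by subst l; apply/esym/col_span_eq_rank.
Qed.

Lemma pid_mx_std n i (x : 'cV[A]_n) : std_span i x -> pid_mx i *m x = x.
Proof.
move=> xi; apply/matrixP=> p z; rewrite ord1 mxE (bigD1 p) //= big1 => [|q qp].
  rewrite mxE eqxx addr0 /=; case: ltnP => [_|/xi->]; by rewrite ?mul1r ?mulr0.
rewrite mxE (_ : (p == q :> nat) = false) ?mul0r //.
by apply: contraNF qp => /eqP e; apply/eqP/val_inj.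
Qed.

Lemma range_pid_mx n (k : 'M[A]_n) i : (i <= n)%N ->
  range (fun u : 'cV_i => k *m pid_mx i *m u) = col_span k i.
Proof.
move=> i_n; apply/seteqP; split=> [_ [u _ <-]|_ [x xi <-]].
  exists (pid_mx i *m u); last by rewrite mulmxA.
  by move=> p ip; rewrite mxE big1 // => q _; rewrite mxE ltnNge ip andbF mul0r.
exists (pid_mx i *m x) => //.
by rewrite -mulmxA [pid_mx i *m (_ *m _)]mulmxA pid_mx_id // pid_mx_std.
Qed.

Lemma free_submoduleP m (M : set 'cV[A]_m.+1) :
  free_submodule M <->
  exists k i, [/\ invertible k, (i <= m.+1)%N & M = col_span k i].
Proof.
split=> [[i [B [Binj ->]]]|[k [i [[k' kk'] i_n ->]]]].
  have [|i_n [k kI BE]] := @injective_completion _ _ B.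
    by move=> x Bx; apply: Binj; rewrite Bx mulmx0.
  by exists k, i; split=> //; rewrite -range_pid_mx // -BE.
exists i, (k *m pid_mx i); split; last by rewrite range_pid_mx.
have K : (pid_mx i *m k') *m (k *m pid_mx i) = 1%:M :> 'M[A]_i.
  by rewrite mulmxA -(mulmxA _ k') (mulmx1C kk') mulmx1 pid_mx_id // pid_mx_1.
by move=> u v uv; rewrite -[u]mul1mx -K -mulmxA uv mulmxA K mul1mx.
Qed.

Lemma proj_free_vertexP m (M : set 'cV[A]_m.+1) :
  proj_free_vertex M <->
  exists k i, [/\ invertible k, (0 < i < m.+1)%N & M = col_span k i].
Proof.
split=> [[/free_submoduleP[k [i [kI i_n ->]]] [_ M0] [_ MT]]|].
  exists k, i; split=> //; apply/andP; split.
    by rewrite lt0n; apply/eqP => i0; apply: M0; rewrite i0 col_span0.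
  by rewrite ltnNge; apply/negP => ni; apply: MT; rewrite col_span_full.
move=> [k [i [kI /andP[i0 i_n] ->]]]; split.
- by apply/free_submoduleP; exists k, i; split=> //; apply: ltnW.
- split=> [_ ->|]; first by exists 0; rewrite ?mulmx0 // => p; rewrite mxE.
  rewrite -(col_span0 k) => S.
  have [] := col_span_refine (leq0n _) (ltnW i_n) kI kI S.
  by rewrite leqNgt i0.
- split=> //; rewrite -(col_span_full kI (leqnn _)) => S.
  have [] := col_span_refine (ltnW i_n) (leqnn _) kI kI S.
  by rewrite leqNgt i_n.
Qed.

Lemma proj_free_cellsP m (s : set (set 'cV[A]_m.+1)) :
  proj_free_cells s <->
  exists2 k, invertible k & s `<=` col_span k @` [set i | (0 < i < m.+1)%N].
Proof.
split=> [[_ sv schain]|[k kI sk]].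
  have [|k kI kP] := flag_extension _ schain.
    move=> N /sv/proj_free_vertexP[k [i [kI /andP[_ /ltnW i_n] ->]]].
    by exists k, i.
  exists k => // N sN; have [i i_n NE] := kP _ sN.
  have /proj_free_vertexP[k' [j [k'I jm NE']]] := sv _ sN.
  exists i => //; suff -> : i = j by [].
  apply: col_span_rank kI k'I _ => //; last by rewrite -NE.
  by case/andP: jm => _ /ltnW.
split.
- apply: sub_finite_set sk _; apply: finite_image.
  apply: sub_finite_set (finite_II m.+1) => i /=; by case/andP.
- by move=> N /sk[i i_m <-]; apply/proj_free_vertexP; exists k, i.
- move=> M N /sk[i _ <-] /sk[j _ <-].
  by have [/col_span_le|/ltnW/col_span_le] := leqP i j; [left|right].
Qed.

End Socle.
End FreeFlags.

(** * Links in a complex described by flags at a vertex *)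

Section Complexes.
Local Open Scope classical_set_scope.
Local Open Scope card_scope.

Lemma card_range T n (g : 'I_n -> T) : injective g -> range g #= `I_n.
Proof.
move=> ginj; apply: card_eq_trans (card_esym card_II).
by apply: inj_card_eq => x y _ _; apply: ginj.
Qed.

(** Both complexes are generated by families with the same names [(k, i)], and two names coincide in
    [X] exactly when they do in [Y], so matching names is a well defined bijection. A vertex has
    many names, whence [xget]. *)
Lemma generated_complex_iso T (U : pointedType) K I (P : set K) (Q : set I)
    (X : complex T) (Y : complex U) (phi : K -> I -> T) (psi : K -> I -> U) :
  (forall s, X s <-> exists2 k, P k & s `<=` phi k @` Q) ->
  (forall s, Y s <-> exists2 k, P k & s `<=` psi k @` Q) ->
  (forall k k' i j, P k -> P k' -> Q i -> Q j ->
     phi k i = phi k' j <-> psi k i = psi k' j) ->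
  complex_iso X Y.
Proof.
move=> XE YE phipsi.
pose f x := xget point
  [set u | exists k i, [/\ P k, Q i, phi k i = x & psi k i = u]].
have fE k i : P k -> Q i -> f (phi k i) = psi k i.
  move=> Pk Qi; rewrite /f; set S := (X in xget _ X).
  have [k' [i' [Pk' Qi' e <-]]] : S (xget point S).
    by apply: (@xgetI _ _ S (psi k i)); exists k, i.
  exact/phipsi.
have vX x : vertices X x <-> exists k i, [/\ P k, Q i & phi k i = x].
  split=> [/XE[k Pk S]|[k [i [Pk Qi <-]]]].
    by have [i Qi e] := S x erefl; exists k, i.
  by apply/XE; exists k => // _ ->; exists i.
have vY x : vertices Y x <-> exists k i, [/\ P k, Q i & psi k i = x].
  split=> [/YE[k Pk S]|[k [i [Pk Qi <-]]]].
    by have [i Qi e] := S x erefl; exists k, i.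
  by apply/YE; exists k => // _ ->; exists i.
exists f; split; first split.
- by move=> _ /vX[k [i [Pk Qi <-]]]; apply/vY; exists k, i; rewrite fE.
- move=> x y /set_mem/vX[k [i [Pk Qi <-]]] /set_mem/vX[k' [i' [Pk' Qi' <-]]].
  by rewrite !fE // => e; apply/phipsi.
- move=> _ /vY[k [i [Pk Qi <-]]]; exists (phi k i); last exact: fE.
  by apply/vX; exists k, i.
move=> s sX; split=> [/XE[k Pk S]|/YE[k Pk S]].
  apply/YE; exists k => // _ [x /S[i Qi <-] <-].
  by exists i => //; rewrite fE.
apply/XE; exists k => // x sx; have /vX[k' [i' [Pk' Qi' xE]]] := sX _ sx.
have [|i Qi e] := S (f x); first by exists x.
exists i => //; rewrite -xE; apply/phipsi => //.
by rewrite e -xE fE.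
Qed.

End Complexes.

Section Chart.
Local Open Scope ring_scope.
Local Open Scope classical_set_scope.
Local Open Scope card_scope.
Variables (A : comNzRingType) (t : A).
Hypotheses (t_neq0 : t != 0)
  (socle : forall a : A, (exists b, a * b = 1) \/ t * a = 0).
Variables (m : nat) (T : Type) (X : complex T) (C : T).
Local Notation d := m.+1.
Variable v : 'M[A]_d -> nat -> T.
Hypotheses
  (v_eq : forall k k' i j, invertible k -> invertible k' -> (i < d)%N ->
     (j < d)%N -> v k i = v k' j <-> col_span k i = col_span k' j)
  (v0 : forall k, invertible k -> v k 0%N = C)
  (star : forall s, s C ->
     X s <-> exists2 k, invertible k & s `<=` v k @` [set i | (i < d)%N]).

Let v_rank k k' i j : invertible k -> invertible k' -> (i < d)%N ->
  (j < d)%N -> v k i = v k' j -> i = j.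
Proof.
move=> kI k'I id jd /v_eq -/(_ kI k'I id jd).
exact: (col_span_rank t_neq0 socle (ltnW id) (ltnW jd) kI k'I).
Qed.

Lemma link_vertexP s : link X [set C] s <->
  exists2 k, invertible k & s `<=` v k @` [set i | (0 < i < d)%N].
Proof.
split=> [[s' [Xs' sC ->]]|[k kI sk]].
  have [k kI sk] := (star (sC C erefl)).1 Xs'.
  exists k => // x [/sk[i /= id <-] vC]; exists i => //=; rewrite id andbT.
  by rewrite lt0n; apply/eqP => i0; apply: vC; rewrite i0 /= v0.
exists (s `|` [set C]); split; last 1 first.
- rewrite setDUl setDv setU0; apply/seteqP; split=> [x sx|x []//].
  split=> // xC; have [i /= /andP[i0 id] e] := sk _ sx.
  have := @v_rank k k i 0%N kI kI id (ltn0Sn m).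
  by rewrite v0 // e xC => /(_ erefl) z; rewrite z in i0.
- apply/star; first by right.
  exists k => // x [/sk[i /= /andP[_ id] <-]|->]; first by exists i.
  by exists 0%N => //=; rewrite v0.
- by move=> x; right.
Qed.

Lemma link_vertex_iso : complex_iso (link X [set C]) (proj_free m A).
Proof.
apply: (@generated_complex_iso _ _ _ _ (@invertible A d)
  [set i | (0 < i < d)%N] _ _ v (@col_span A d)).
- exact: link_vertexP.
- exact: (proj_free_cellsP t_neq0 socle).
- by move=> k k' i j kI k'I /andP[_ id] /andP[_ jd]; exact: v_eq.
Qed.

(** * Links of cells of codimension two *)

Section Codim2.
Variables (k0 : 'M[A]_d) (a b : nat).
Hypotheses (k0I : invertible k0) (a_gt0 : (0 < a)%N) (ab : (a < b)%N)
  (bd : (b < d)%N).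

Let rest i := [/\ (i < d)%N, i <> a & i <> b].
Let tau := v k0 @` rest.

(** Changes of basis that preserve the flag [tau], read in the basis [k0], where its modules become
    standard spans. *)
Let stab (l : 'M[A]_d) := invertible l /\
  forall i, rest i -> col_span l i = std_span i.
Let w l i := v (k0 *m l) i.
Let ad : (a < d)%N := ltn_trans ab bd.

(** Rank 0 is in [rest] because [a] is positive, so [tau] contains [C] and [star] applies. A vertex
    determines its rank, hence a flag containing [tau] agrees with it in every rank of [rest]. *)
Lemma link_codim2P s : link X tau s <->
  exists2 l, stab l & s `<=` w l @` [set i | i = a \/ i = b].
Proof.
have rest0 : rest 0%N by split=> // e; lia.
have tauC : tau C by exists 0%N => //; rewrite v0.
split=> [[s' [Xs' sub ->]]|[l [lI lP] sl]].
  have [k kI sk] := (star (sub _ tauC)).1 Xs'.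
  case: (k0I) => k0' k00'.
  have kE : k = k0 *m (k0' *m k) by rewrite mulmxA k00' mul1mx.
  have restk i : rest i -> v k i = v k0 i.
    move=> ri; have [id _ _] := ri.
    have [|j /= jd e] := sk (v k0 i); first by apply: sub; exists i.
    by have ij := v_rank kI k0I jd id e; rewrite -e ij.
  exists (k0' *m k).
    split=> [|i ri]; first by apply: invertibleM => //; exists k0; apply: mulmx1C.
    have [id _ _] := ri; rewrite -col_span1; apply/(col_spanMI _ _ _ _ k0I).
    by rewrite -kE mulmx1; apply/v_eq => //; apply: restk.
  move=> x [/sk[i /= id <-] ntau]; exists i; last by rewrite /w -kE.
  apply: contrapT => /not_orP[ia ib]; apply: ntau; exists i => //.
  exact/esym/restk.
have klI := invertibleM k0I lI.
exists (s `|` tau); split; last 1 first.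
- rewrite setDUl setDv setU0; apply/seteqP; split=> [x sx|x []//].
  split=> // -[i [id ia ib] e]; have [j /= jab e'] := sl _ sx.
  have jd : (j < d)%N by case: jab => ->.
  have := @v_rank k0 (k0 *m l) i j k0I klI id jd.
  by rewrite e -e' => /(_ erefl) ij; case: jab => z; rewrite ij z in ia ib.
- apply/star; first by right.
  exists (k0 *m l) => // x [/sl[i /= iab <-]|[i ri <-]].
    by exists i => //=; case: iab => ->.
  have [id _ _] := ri; exists i => //; apply/v_eq => //.
  by rewrite -[X in _ = col_span X _]mulmx1; apply/(col_spanMI _ _ _ _ k0I);
    rewrite col_span1 lP.
- by move=> x; right.
Qed.

Let w_eq l l' i j : invertible l -> invertible l' -> (i < d)%N -> (j < d)%N ->
  w l i = w l' j <-> col_span l i = col_span l' j.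
Proof.
move=> lI l'I id jd; rewrite -(col_spanMI l l' i j k0I).
by apply: v_eq => //; apply: invertibleM.
Qed.

Let stab1 : stab 1%:M.
Proof. by split=> [|i _]; [exact: invertible1|rewrite col_span1]. Qed.

Lemma link_codim2_bipartite : (a.+1 < b)%N -> complete_bipartite (link X tau).
Proof.
move=> a1b.
(* The first [a + 1] columns of [l] are followed by the remaining ones of [l']:
   both matrices stabilize the span of the first [a + 1] coordinates. *)
have glue l l' : stab l -> stab l' ->
    exists2 l2, stab l2 & w l2 a = w l a /\ w l2 b = w l' b.
  move=> [lI lP] [l'I l'P]; case: (l'I) => h h1.
  have h2 := mulmx1C h1.
  have hP i : rest i -> col_span (h *m l) i = std_span i.
    move=> ri; rewrite -col_span1; apply/(col_spanMI _ _ _ _ l'I).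
    by rewrite mulmxA h1 mul1mx mulmx1 lP // l'P.
  have a1d : (0 + a.+1 <= d)%N by lia.
  have ra1 : rest a.+1 by split; lia.
  pose m0 := window a1d (h *m l).
  have m0I : invertible m0.
    case: (lI) => h' h'1; exists (window a1d (h' *m l')).
    have hP' : col_span (h' *m l') a.+1 = std_span a.+1.
      rewrite -col_span1; apply/(col_spanMI _ _ _ _ lI).
      by rewrite mulmxA h'1 mul1mx mulmx1 lP // l'P.
    rewrite -windowM.
    - by rewrite mulmxA -(mulmxA h) h'1 mulmx1 h2 window1.
    - by rewrite !(col_span0, std_span0).
    - by rewrite add0n hP'.
  (* The first [a + 1] columns of [h *m l] vanish below the block [m0], so those of [l2] equal those
     of [l' *m (h *m l) = l]; on the other columns the factor is the identity. *)
  pose l2 := l' *m window_ext a1d m0.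
  have l2I : invertible l2.
    by apply: invertibleM => //; apply: window_ext_invertible.
  have l2_lo q : (q < a.+1)%N -> forall qd : (q < d)%N,
      col (Ordinal qd) l2 = col (Ordinal qd) l.
    move=> qa qd; rewrite -[l]mul1mx -h1 -mulmxA /l2 !colE -!mulmxA.
    congr (_ *m _); rewrite mulmxA -!colE; apply/matrixP=> p z; rewrite mxE [RHS]mxE.
    have [pa|ap] := ltnP p a.+1.
      have -> : p = window_ord a1d (Ordinal pa) by apply: val_inj.
      have -> : Ordinal qd = window_ord a1d (Ordinal qa) by apply: val_inj.
      by rewrite window_extE mxE.
    have /std_spanP -> // : col_span (h *m l) a.+1 `<=` std_span a.+1.
      by rewrite hP.
    rewrite window_ext_out; last by rewrite /in_window /= ltnNge ap.
    by case: eqP => // pq; move: ap; rewrite pq /= leqNgt qa.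
  have l2_hi i : (a.+1 <= i)%N -> (i < d)%N -> col_span l2 i = col_span l' i.
    move=> ai id; rewrite /l2 -[X in _ = col_span X _]mulmx1.
    apply/(col_spanMI _ _ _ _ l'I).
    by rewrite col_span1 window_ext_std //; apply/negP; lia.
  have l2_lo' i : (i <= a)%N -> col_span l2 i = col_span l i.
    move=> ia; apply: eq_col_span => -[q qd] /= qi; apply: l2_lo.
    by rewrite ltnS (leq_trans (ltnW qi) ia).
  exists l2; last first.
    by split; apply/w_eq => //; [exact: l2_lo'|apply: l2_hi => //; lia].
  split=> // i ri; have [id _ _] := ri.
  have [ia|ai] := leqP i a; first by rewrite l2_lo' // lP.
  by rewrite l2_hi // l'P.
exists [set w l a | l in stab], [set w l b | l in stab]; split.
- by exists (w 1%:M a), 1%:M.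
- by exists (w 1%:M b), 1%:M.
- apply/seteqP; split=> // _ [[l [lI _] <-] [l' [l'I _]]].
  move/(v_rank (invertibleM k0I l'I) (invertibleM k0I lI) bd ad) => e.
  by move: ab; rewrite e ltnn.
move=> s; split=> [/link_codim2P[l lS sl]|].
  have sub : s `<=` [set w l a; w l b].
    by move=> x /sl[i /= [] -> <-]; [left|right].
  have [sa|sa] := pselect (s (w l a)); have [sb|sb] := pselect (s (w l b)).
  - apply: Or33; exists (w l a), (w l b); split; [by exists l|by exists l|].
    by apply/seteqP; split=> // x [] ->.
  - apply: Or32; exists (w l a); first by left; exists l.
    apply/seteqP; split=> [x sx|x -> //].
    by case: (sub _ sx) => // xb; rewrite xb in sx.
  - apply: Or32; exists (w l b); first by right; exists l.
    apply/seteqP; split=> [x sx|x -> //].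
    by case: (sub _ sx) => // xb; rewrite xb in sx.
  - apply: Or31; apply/seteqP; split=> // x sx.
    by case: (sub _ sx) => xb; rewrite xb in sx.
case=> [->|[x xAB ->]|[x [y [[l lS <-] [l' l'S <-] ->]]]]; apply/link_codim2P.
- by exists 1%:M.
- by case: xAB => -[l lS <-]; exists l => // _ ->;
    [exists a; [left|]|exists b; [right|]].
- have [l2 l2S [e1 e2]] := glue _ _ lS l'S; exists l2 => // _ [] ->.
    by exists a; [left|].
  by exists b; [right|].
Qed.

Lemma link_codim2_plane : b = a.+1 -> complex_iso (link X tau) (proj_free 2 A).
Proof.
move=> ba.
(* The window has the three coordinates from [lo] to [lo + 2], with [a = lo + 1] and [b = lo + 2].
   Both its end ranks lie in [rest], except that [lo + 3] may be [d], where the span is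
   everything. *)
have [lo aE] : exists lo, a = lo.+1 by exists a.-1; lia.
have wd : (lo + 3 <= d)%N by lia.
have rlo : rest lo by split; lia.
have rhi : rest (lo + 3) \/ (lo + 3)%N = d.
  by case: (ltngtP (lo + 3)%N d) => [|//|]; [left; split; lia|lia|right].
have hiP l : stab l -> col_span l (lo + 3) = std_span (lo + 3).
  move=> [lI lP]; case: rhi => [/lP //|->].
  by rewrite col_span_full // std_span_full.
have loP l : stab l -> col_span l lo = std_span lo by move=> [_ lP]; exact: lP.
have stabV l : stab l -> exists2 h, stab h & h *m l = 1%:M.
  move=> [lI lP]; case: (lI) => h lh; exists h; last exact: mulmx1C.
  split=> [|i ri]; first by exists l; apply: mulmx1C.
  by rewrite -col_span1; apply/(col_spanMI _ _ _ _ lI); rewrite lh mulmx1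
    col_span1 lP.
have winM l l' : stab l -> stab l' ->
    window wd (l *m l') = window wd l *m window wd l'.
  by move=> lS l'S; rewrite windowM // ?loP ?hiP.
have winI l : stab l -> invertible (window wd l).
  move=> lS; have [h hS hl] := stabV _ lS; exists (window wd h).
  by apply: mulmx1C; rewrite -winM // hl window1.
(* With [g] the inverse of [l'] times [l], inclusion means that certain entries of [g] vanish;
   outside the window they vanish anyway, since [g] stabilizes both ends. *)
have sub_win l l' i : stab l -> stab l' -> (i <= 3)%N ->
    col_span l (lo + i) `<=` col_span l' (lo + i) <->
    col_span (window wd l) i `<=` col_span (window wd l') i.
  move=> lS l'S i3; have [h hS hl] := stabV _ l'S.
  have lh := mulmx1C hl.
  pose g := h *m l; have gS : stab g.
    split=> [|j rj]; first by apply: invertibleM; [case: hS|case: lS].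
    have [_ lP] := lS; have [_ hP] := hS.
    by rewrite col_spanM lP // -[RHS]hP.
  have lE : l = l' *m g by rewrite mulmxA lh mul1mx.
  have l'I : invertible l' by case: l'S.
  rewrite lE winM // -[X in _ `<=` col_span X _ <-> _](mulmx1 l').
  rewrite (col_spanMS _ _ _ _ l'I) -[X in _ <-> _ `<=` col_span X _]mulmx1.
  rewrite (col_spanMS _ _ _ _ (winI _ l'S)) !col_span1 !std_spanP.
  split=> H p q ip qi.
    by rewrite mxE; apply: H; rewrite ?leq_add2l ?ltn_add2l.
  have [qlo|loq] := ltnP q lo.
    have /std_spanP -> // : col_span g lo `<=` std_span lo by rewrite loP.
    by apply: leq_trans ip; apply: leq_addr.
  have [hip|phi] := leqP (lo + 3) p.
    have /std_spanP -> // : col_span g (lo + 3) `<=` std_span (lo + 3).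
      by rewrite hiP.
    by apply: leq_trans qi _; rewrite leq_add2l.
  have pwin : in_window 3 lo p.
    by rewrite /in_window phi andbT; apply: leq_trans ip; apply: leq_addr.
  have qwin : in_window 3 lo q.
    by rewrite /in_window loq; apply: leq_trans qi _; rewrite leq_add2l.
  case/(in_windowP wd): pwin ip => p' -> ip; case/(in_windowP wd): qwin qi => q' -> qi.
  by move: ip qi; rewrite leq_add2l ltn_add2l => /H/[apply]; rewrite mxE.
apply: (@generated_complex_iso _ _ _ _ stab [set i | i = a \/ i = b] _ _ w
  (fun l i => col_span (window wd l) (i - lo))).
- exact: link_codim2P.
- move=> s; split=> [/(proj_free_cellsP t_neq0 socle)[k kI sk]|[l lS sl]].
    (* The only ranks strictly inside the window are [a] and [b], so the extension of any invertible
       3 by 3 matrix is in [stab]. *)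
    exists (window_ext wd k).
      split=> [|i [id ia ib]]; first exact: window_ext_invertible.
      by apply: window_ext_std => //; apply/negP; lia.
    move=> x /sk[i /= i13 <-]; rewrite window_extK; exists (i + lo)%N.
      by lia.
    by rewrite addnK.
  apply/(proj_free_cellsP t_neq0 socle); exists (window wd l); first exact: winI.
  by move=> x /sl[i /= iab <-]; exists (i - lo)%N => //=; lia.
move=> l l' i j lS l'S /= iab jab.
have [lI _] := lS; have [l'I _] := l'S.
have id : (i < d)%N by lia.
have jd : (j < d)%N by lia.
rewrite w_eq //.
have [i' iE] : exists i', i = (lo + i')%N by exists (i - lo)%N; lia.
have [j' jE] : exists j', j = (lo + j')%N by exists (j - lo)%N; lia.
have [i3 j3] : (i' <= 3)%N /\ (j' <= 3)%N by lia.
subst i j; rewrite !addKn; split=> e.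
  have /addnI ij := col_span_rank t_neq0 socle (ltnW id) (ltnW jd) lI l'I e.
  by subst j'; apply/seteqP; split; apply/sub_win => //; rewrite e.
have ij := col_span_rank t_neq0 socle i3 j3 (winI _ lS) (winI _ l'S) e.
by subst j'; apply/seteqP; split; apply/sub_win => //; rewrite e.
Qed.

End Codim2.
(** The set [S] of ranks occurring in [tau] has [(d - 3).+1 = d - 2] elements, so exactly two ranks
    are missing; neither is 0, the rank of [C]. Whether they are consecutive decides between the two
    cases. *)
Lemma link_codim2 tau : (2 < d)%N -> tau C -> dim_cells X (d - 3) tau ->
  complete_bipartite (link X tau) \/ complex_iso (link X tau) (proj_free 2 A).
Proof.
move=> d3 tauC [Xtau cardtau].
have [k0 k0I sub] := (star tauC).1 Xtau.
pose S : {set 'I_d} := [set i : 'I_d | `[< tau (v k0 i) >]]%SET.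
pose g (j : 'I_#|S|) := v k0 (enum_val j).
have ginj : injective g.
  move=> j j' /(v_rank k0I k0I (ltn_ord _) (ltn_ord _))/val_inj.
  exact: enum_val_inj.
have grange : range g = tau.
  apply/seteqP; split=> [_ [j _ <-]|x tx].
    by have := enum_valP j; rewrite inE => /asboolP.
  have [i /= id e] := sub _ tx.
  have iS : Ordinal id \in S by rewrite inE; apply/asboolP; rewrite /= e.
  by exists (enum_rank_in iS (Ordinal id)) => //; rewrite /g enum_rankK_in.
have /card_eq_II cardS : `I_(d - 3).+1 #= `I_#|S|.
  apply: card_eq_trans (card_range ginj); rewrite grange.
  exact: card_esym.
have cardCS : #|~: S|%SET == 2%N.
  by apply/eqP; rewrite cardsCs finset.setCK card_ord -cardS; lia.
have [a0 [b0 [ab0 SE]]] := cards2P _ cardCS.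
have [a [b [ab SE']]] : exists a b : 'I_d, (a < b)%N /\ (~: S = [set a; b])%SET.
  have [ab|ba|/val_inj e] := ltngtP a0 b0.
  - by exists a0, b0.
  - by exists b0, a0; rewrite finset.setUC.
  - by rewrite e eqxx in ab0.
have tauP i : (i < d)%N -> tau (v k0 i) <-> i <> a /\ i <> b.
  move=> id; have : (Ordinal id \in ~: S)%SET = (Ordinal id \in [set a; b])%SET.
    by rewrite SE'.
  rewrite !inE -!val_eqE /= => e; rewrite -(asboolE (tau _)).
  by rewrite -[`[< _ >]]negbK e negb_or; split=> [/andP[/eqP ? /eqP ?]|[? ?]] //;
    apply/andP; split; apply/eqP.
have tauE : tau = v k0 @` (fun i => [/\ (i < d)%N, i <> a & i <> b]).
  apply/seteqP; split=> [x tx|_ [i [id ia ib] <-]]; last exact/tauP.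
  have [i /= id e] := sub _ tx; exists i => //.
  by have /(tauP _ id) [] : tau (v k0 i) by rewrite e.
have a_gt0 : (0 < a)%N.
  rewrite lt0n; apply/eqP => a0E.
  have /tauP[//|] : tau (v k0 a) by rewrite a0E v0.
  by [].
rewrite tauE; have [a1b|] := ltnP a.+1 b.
  by left; apply: link_codim2_bipartite.
move=> ba; right; apply: link_codim2_plane => //.
by apply/eqP; rewrite eqn_leq ba ab.
Qed.

End Chart.

(** * Lattices and geodesics *)

Section Lattices.
Local Open Scope ring_scope.
Local Open Scope classical_set_scope.
Local Open Scope card_scope.
Variables (F : fieldType) (V : valuation F).
Local Notation pi := (unif V).
Local Notation O := (integral V).

Lemma integral_ord x : x != 0 -> (x \in O) = (0 <= ord V x).
Proof. by move=> x0; rewrite !inE (negPf x0). Qed.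

Lemma unifX_neq0 n : pi ^+ n != 0.
Proof. by rewrite expf_neq0 ?unif_neq0. Qed.

Lemma ord_unifX n : ord V (pi ^+ n) = n%:Z.
Proof. by rewrite ord_expr ?unif_neq0 // ord_unif natz. Qed.

Lemma ordV x : x != 0 -> ord V x^-1 = - ord V x.
Proof.
move=> x0; apply/eqP; rewrite -addr_eq0 -ordM ?invr_eq0 // mulVf //.
by rewrite Defs.ord1.
Qed.

Lemma integral_unif : pi \in O.
Proof. by rewrite integral_ord ?unif_neq0 // ord_unif. Qed.

Lemma integral_unifX n : pi ^+ n \in O.
Proof. by rewrite rpredX // integral_unif. Qed.

Section Scale.
Variable d : nat.
Implicit Types (L : set 'cV[F]_d) (g h : 'M[F]_d).

Lemma scaleP c L x : c != 0 -> scale c L x <-> L (c^-1 *: x).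
Proof.
move=> c0; split=> [[y Ly <-]|Lx]; first by rewrite scalerA mulVf ?scale1r.
by exists (c^-1 *: x) => //; rewrite scalerA mulfV ?scale1r.
Qed.

Lemma scale1 L : scale 1 L = L.
Proof. by apply: eq_image_id => x _; rewrite scale1r. Qed.

Lemma scaleM a b L : scale a (scale b L) = scale (a * b) L.
Proof.
by rewrite /scale image_comp; apply: eq_imagel => x _ /=; rewrite scalerA.
Qed.

Lemma scale_sub c L L' : c != 0 -> scale c L `<=` scale c L' <-> L `<=` L'.
Proof.
move=> c0; split=> [S x Lx|]; last exact: image_subset.
have /(scaleP _ _ c0) : scale c L' (c *: x) by apply: S; exists x.
by rewrite scalerA mulVf ?scale1r.
Qed.

Lemma homothety_class_id L : homothety_class L L.
Proof. by exists 1; rewrite ?scale1 //= oner_neq0. Qed.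

Lemma homothety_class_scale c L : c != 0 ->
  homothety_class (scale c L) = homothety_class L.
Proof.
move=> c0; apply/seteqP; split=> [_ [a a0 <-]|_ [a a0 <-]].
  by exists (a * c); rewrite ?scaleM //= mulf_neq0.
exists (a / c); first by rewrite /= mulf_neq0 ?invr_eq0.
by rewrite scaleM -mulrA mulVf ?mulr1.
Qed.

Lemma latticeZ c g : scale c (lattice V g) = lattice V (c *: g).
Proof.
rewrite /scale /lattice image_comp; apply: eq_imagel => x _ /=.
by rewrite scalemxAl.
Qed.

Lemma latticeP g x : g \in unitmx ->
  lattice V g x <-> invmx g *m x \is a mxOver O.
Proof.
move=> gU; split=> [[y yO <-]|xO]; first by rewrite mulKmx.
by exists (invmx g *m x); rewrite ?mulKVmx.
Qed.

Lemma mxOverM_integral a b c (x : 'M[F]_(a, b)) (y : 'M[F]_(b, c)) :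
  x \is a mxOver O -> y \is a mxOver O -> x *m y \is a mxOver O.
Proof.
move=> /mxOverP xO /mxOverP yO; apply/mxOverP=> i j; rewrite mxE.
by apply: rpred_sum => q _; rewrite rpredM.
Qed.

Lemma lattice_sub g h : g \in unitmx -> h \in unitmx ->
  lattice V g `<=` lattice V h <-> invmx h *m g \is a mxOver O.
Proof.
move=> gU hU; split=> [S|hgO _ [x xO <-]].
  rewrite -[_ *m g]scale1r -(invr1 F).
  by apply: lattice_sub_scale; rewrite ?oner_neq0 ?scale1.
by apply/latticeP => //; rewrite mulmxA mxOverM_integral.
Qed.

Lemma det_neq0 g : g \in unitmx -> \det g != 0.
Proof. by rewrite unitmxE unitfE. Qed.

Lemma lattice_det_le g h : g \in unitmx -> h \in unitmx ->
  lattice V g `<=` lattice V h -> ord V (\det h) <= ord V (\det g).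
Proof.
move=> gU hU /(lattice_sub gU hU)/mxOver_det.
have [g0 h0] := (det_neq0 gU, det_neq0 hU).
rewrite det_mulmx det_inv integral_ord ?mulf_neq0 ?invr_eq0 //.
by rewrite ordM ?invr_eq0 // ordV // addrC subr_ge0.
Qed.

Lemma ord_detZ c g : c != 0 -> g \in unitmx ->
  ord V (\det (c *: g)) = ord V c *+ d + ord V (\det g).
Proof.
by move=> c0 /det_neq0 g0; rewrite detZ ordM ?expf_neq0 // ord_expr.
Qed.

Lemma invmx_integral (k : 'M_d) : k \is a mxOver O -> \det k != 0 ->
  ord V (\det k) = 0 -> invmx k \is a mxOver O.
Proof.
move=> /mxOverP kO k0 ok.
unfold invmx; rewrite unitmxE unitfE k0.
apply/mxOverP=> i j; rewrite mxE rpredM //.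
  by rewrite integral_ord ?invr_eq0 // ordV // ok oppr0.
rewrite mxE /cofactor rpredM ?rpredX ?rpredN1 //.
by apply: mxOver_det; apply/mxOverP=> p q; rewrite !mxE.
Qed.

Lemma scale_unitmx c g : c != 0 -> g \in unitmx -> c *: g \in unitmx.
Proof.
by move=> c0 /det_neq0 g0; rewrite unitmxE detZ unitfE mulf_neq0 ?expf_neq0.
Qed.

Lemma latticeD g x y : lattice V g x -> lattice V g y -> lattice V g (x + y).
Proof.
by move=> [u uO <-] [w wO <-]; exists (u + w); rewrite ?mulmxDr //= rpredD.
Qed.

Lemma lattice_scalar g a x : a \in O -> lattice V g x -> lattice V g (a *: x).
Proof.
move=> aO [u /mxOverP uO <-]; exists (a *: u); last by rewrite -scalemxAr.
by apply/mxOverP=> i j; rewrite mxE rpredM.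
Qed.

(* Replacing in [h] the column where [invmx h *m x] is not integral by [x]
   lowers the valuation of the determinant by one, which gives a basis of
   [lattice g]. *)
Lemma maximal_sublattice g h x y : g \in unitmx -> h \in unitmx ->
  lattice V h `<=` lattice V g -> scale pi (lattice V g) `<=` lattice V h ->
  ord V (\det h) = ord V (\det g) + 1 ->
  lattice V g x -> ~ lattice V h x -> lattice V g y ->
  exists2 a, a \in O & lattice V h (y - a *: x).
Proof.
move=> gU hU hg gh oh gx nhx gy.
have [z zE] : exists z, z = invmx h *m x by exists (invmx h *m x).
have xE : x = h *m z by rewrite zE mulKVmx.
have [p zp] : exists p, z p 0 \notin O.
  apply: contrapT => H; apply: nhx; apply/latticeP => //; apply/mxOverP=> p q.
  by rewrite ord1 -zE; apply: contrapT => /negP zp; apply: H; exists p.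
have zp0 : z p 0 != 0 by apply: contraNneq zp => ->; rewrite rpred0.
(* [pi *: x] lies in [lattice V h], so a coordinate that is not integral has valuation exactly
   -1. *)
have ozp : ord V (z p 0) = -1.
  have : pi * z p 0 \in O.
    have /(latticeP _ hU)/mxOverP/(_ p 0) : lattice V h (pi *: x).
      by apply: gh; exists x.
    by rewrite -scalemxAr -zE mxE.
  rewrite integral_ord ?mulf_neq0 ?unif_neq0 // ordM ?unif_neq0 // ord_unif.
  move: zp; rewrite integral_ord //; lia.
pose W : 'M[F]_d := \matrix_(i, j) if j == p then z i 0 else (i == j)%:R.
have detW : \det W = z p 0.
  rewrite (expand_det_row _ p) (bigD1 p) //= big1 => [|j jp]; last first.
    by rewrite mxE (negPf jp) eq_sym (negPf jp) mul0r.
  rewrite mxE eqxx addr0 /cofactor -signr_odd oddD addbb mul1r.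
  rewrite (_ : row' p (col' p W) = 1%:M) ?det1 ?mulr1 //.
  apply/matrixP=> i j; rewrite !mxE eq_sym (negPf (neq_lift _ _)).
  by rewrite (inj_eq lift_inj).
have WU : W \in unitmx by rewrite unitmxE unitfE detW.
have Wu u : W *m u = \col_i (if i == p then 0 else u i 0) + u p 0 *: z.
  apply/matrixP=> i j; rewrite ord1 [LHS]mxE (bigD1 p) //= !mxE eqxx addrC.
  rewrite [z i 0 * _]mulrC; congr (_ + _).
  have [ip|ip] := eqVneq i p.
    rewrite big1 // => q qp; rewrite mxE (negPf qp) ip eq_sym (negPf qp).
    by rewrite mul0r.
  rewrite (bigD1 i) //= big1 => [|q /andP[qp qi]].
    by rewrite mxE (negPf ip) eqxx mul1r addr0.
  by rewrite mxE (negPf qp) eq_sym (negPf qi) mul0r.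
have hWO : invmx g *m (h *m W) \is a mxOver O.
  apply/mxOverP=> i j.
  rewrite (_ : (invmx g *m (h *m W)) i j = (invmx g *m (h *m col j W)) i 0).
    have : lattice V g (h *m col j W).
      have [->|jp] := eqVneq j p.
        rewrite (_ : col p W = z) -?xE //.
        by apply/matrixP=> a b; rewrite !mxE eqxx ord1.
      apply: hg; rewrite (_ : col j W = delta_mx j 0) -?colE; first exact: lattice_col.
      by apply/matrixP=> a b; rewrite !mxE (negPf jp) ord1 eqxx andbT.
    by move/(latticeP _ gU)/mxOverP.
  by rewrite !colE !mulmxA -colE [RHS]mxE.
have [g0 h0] := (det_neq0 gU, det_neq0 hU).
have hWU : h *m W \in unitmx by rewrite unitmx_mul hU.
(* [h *m W] spans a sublattice of [lattice V g], and by [oh] and [ozp] the two determinants have the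
   same valuation, so the lattices coincide. *)
have : lattice V g `<=` lattice V (h *m W).
  apply/lattice_sub => //.
  have U : invmx g *m (h *m W) \in unitmx by rewrite unitmx_mul unitmx_inv gU.
  have -> : invmx (h *m W) *m g = invmx (invmx g *m (h *m W)).
    apply: (can_inj (mulKmx U)); rewrite mulmxV //.
    by rewrite mulmxA -(mulmxA _ (h *m W)) mulmxV // mulmx1 mulVmx.
  apply: invmx_integral => //; first exact: det_neq0.
  rewrite !det_mulmx det_inv detW !ordM ?mulf_neq0 ?invr_eq0 // ordV // ozp oh.
  by rewrite addrK addNr.
move=> /(_ y gy) [u /mxOverP uO yE]; exists (u p 0); first exact: uO.
rewrite -yE -mulmxA Wu mulmxDr -scalemxAr -xE addrK.
exists (\col_i (if i == p then 0 else u i 0)) => //.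
by apply/mxOverP => i j; rewrite mxE; case: ifP => // _; rewrite rpred0.
Qed.

End Scale.
End Lattices.

(** * Edges and geodesics as chains of sublattices *)

Section Geodesics.
Local Open Scope ring_scope.
Local Open Scope classical_set_scope.
Local Open Scope card_scope.

Lemma card_pairP T (a b : T) : [set a; b] #= `I_2 <-> a <> b.
Proof.
split=> [c2 ab|ab].
  move: c2; rewrite ab setUid => c2.
  have /card_eq_II// : `I_1 #= `I_2.
  by apply: card_eq_trans c2; apply: card_esym card_set1.
rewrite (_ : [set a; b] = range (fun i : 'I_2 => if i == 0 :> nat then a else b)).
  apply: card_range => -[[|[|//]] ?] [[|[|//]] ?] //= e; try exact: val_inj.
  by case: ab.
apply/seteqP; split=> [x [->|->]|_ [i _ <-]].
- by exists 0.
- by exists 1.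
- by case: ifP; [left|right].
Qed.

Lemma card_triple T (a b c : T) : a <> b -> b <> c -> a <> c ->
  [set a; b; c] #= `I_3.
Proof.
move=> ab bc ac.
pose f (i : 'I_3) := match val i with 0%N => a | 1%N => b | _ => c end.
rewrite (_ : [set a; b; c] = range f).
  apply: card_range => -[[|[|[|//]]] ?] [[|[|[|//]]] ?];
    rewrite /f /= => e; try exact: val_inj; by [case: ab|case: bc|case: ac].
apply/seteqP; split=> [x [[->|->]|->]|_ [[[|[|[|//]]] ?] _ <-]].
- by exists ord0.
- by exists (lift ord0 ord0).
- by exists ord_max.
- by left; left.
- by left; right.
- by right.
Qed.

Variables (F : fieldType) (V : valuation F) (d : nat) (d_gt1 : (1 < d)%N).
Local Notation pi := (unif V).
Local Notation O := (integral V).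
Implicit Types (C D : set (set 'cV[F]_d)) (g h : 'M[F]_d).

Lemma adjacent_sym C D : building_vertex V C -> adjacent V C D -> adjacent V D C.
Proof.
move=> [L0 _ ->] [CD [L [L' [CL DL' [S1 S1'] [S2 S2']]]]].
split; first by move=> e; apply: CD.
exists L', (scale pi L); split=> //.
- case: CL => c c0 <-; exists (pi * c); first by rewrite /= mulf_neq0 ?unif_neq0.
  by rewrite scaleM.
- split; first exact/(scale_sub _ _ (unif_neq0 V)).
  by move/(scale_sub _ _ (unif_neq0 V)).
Qed.

Lemma building_pairP C D : dim_cells (building V d) 1 [set C; D] <->
  [/\ building_vertex V C, building_vertex V D & adjacent V C D].
Proof.
split=> [[[_ bv adj] /card_pairP CD]|[vC vD aCD]].
  by split; [apply: bv; left|apply: bv; right|apply: adj => //; [left|right]].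
have CD : C <> D by case: aCD.
split; last exact/card_pairP.
split; first exact: finite_set2.
- by move=> x [] ->.
- move=> x y [] -> [] -> // _; exact: adjacent_sym.
Qed.

Lemma building_tripleP C D E :
  building_vertex V C -> building_vertex V D -> building_vertex V E ->
  dim_cells (building V d) 2 [set C; D; E] <->
  [/\ adjacent V C D, adjacent V D E & adjacent V C E].
Proof.
move=> vC vD vE; split=> [[[_ _ adj] c3]|[CD DE CE]].
  have [CD DE CE] : [/\ C <> D, D <> E & C <> E].
    have no2 x y : ~ ([set C; D; E] `<=` [set x; y]).
      move=> /subset_card_le le; have : `I_3 #<= `I_2; last by rewrite card_le_II.
      apply: card_le_trans (card_le_trans le _).
        by have := card_esym c3; rewrite card_eq_le => /andP[].
      have [xy|/card_pairP] := pselect (x = y).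
        rewrite xy setUid; apply: (@card_le_trans _ _ _ `I_1).
          by have := @card_set1 _ y; rewrite card_eq_le => /andP[].
        by rewrite card_le_II.
      by rewrite card_eq_le => /andP[].
    split=> e.
    - by apply: (no2 D E) => x [[->|->]|->]; rewrite ?e; [left|left|right].
    - by apply: (no2 C E) => x [[->|->]|->]; rewrite ?e; [left|right|right].
    - by apply: (no2 D E) => x [[->|->]|->]; rewrite ?e; [right|left|right].
  by split; apply: adj => //;
    [left; left|left; right|left; right|right|left; left|right].
have [nCD nDE nCE] : [/\ C <> D, D <> E & C <> E].
  by split; [case: CD|case: DE|case: CE].
split; last exact: card_triple.
split.
- by rewrite -setUA finite_setU; split; [exact: finite_set1|exact: finite_set2].
- by move=> x [[->|->]|->].
- by move=> x y [[->|->]|->] [[->|->]|->] // _; apply: adjacent_sym.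
Qed.

(** Once the representative of [D] lies between [pi L] and [L], the valuations of the determinants
    differ by a number from 0 to [d]. It is 1 modulo [d], and [d > 1], so it is 1. *)
Lemma edge_sublattice C D g : g \in unitmx -> C = homothety_class (lattice V g) ->
  dim_cells (building V d) 1 [set C; D] -> edge_color V C D = 1 ->
  exists h, [/\ h \in unitmx, D = homothety_class (lattice V h),
    lattice V h `<=` lattice V g, scale pi (lattice V g) `<=` lattice V h &
    ord V (\det h) = ord V (\det g) + 1].
Proof.
move=> gU CE /building_pairP[_ [_ [h0 h0U ->] DE] [_ [L [L' []]]]].
rewrite {1}CE {1}DE => -[c c0 <-] [c' c'0 <-] [S1 _] [S2 _] col.
pose h := (c^-1 * c') *: h0.
have u0 : c^-1 * c' != 0 by rewrite mulf_neq0 ?invr_eq0.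
have hU : h \in unitmx by apply: scale_unitmx.
have hE : scale c' (lattice V h0) = scale c (lattice V h).
  by rewrite -latticeZ scaleM mulrA mulfV ?mul1r.
rewrite hE in S1 S2.
have hg : lattice V h `<=` lattice V g by apply/(scale_sub _ _ c0).
have gh : scale pi (lattice V g) `<=` lattice V h.
  by apply/(scale_sub _ _ c0); rewrite scaleM mulrC -scaleM.
have Dh : D = homothety_class (lattice V h).
  by rewrite DE -latticeZ homothety_class_scale.
exists h; split=> //.
have := lattice_det_le hU gU hg.
have := gh; rewrite latticeZ => /(lattice_det_le (scale_unitmx (unif_neq0 V) gU) hU).
rewrite ord_detZ ?unif_neq0 // ord_unif natz.
move: col; rewrite /edge_color CE Dh !vertex_color_class // -intrB.
set x := ord V (\det h); set y := ord V (\det g) => col le1 le2.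
have [e [eE ed]] : exists e : nat, x - y = e%:Z /\ (e <= d)%N.
  by exists `|x - y|%N; lia.
move: col; rewrite eE -pmulrn => /(congr1 val).
rewrite /= val_Zp_nat // => e1; suff : e = 1%N by lia.
move: e1; rewrite -[X in _ = X -> _]/(1 %% (Zp_trunc d).+2)%N Zp_cast //.
rewrite (modn_small d_gt1); have [ed'|de] := ltnP e d; first by rewrite modn_small.
have -> : e = d by lia.
by rewrite modnn.
Qed.

(* [e] is any vector outside the first proper lattice of the path: [pi^n e] stays
   outside the [(n+1)]-st one, for otherwise two steps of the path would contain
   [pi] times the lattice they start from. *)
Lemma geodesic_cyclic r C D g : (0 < r)%N -> g \in unitmx ->
  C = homothety_class (lattice V g) -> geodesic V r C D ->
  exists h e, [/\ h \in unitmx, D = homothety_class (lattice V h),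
    lattice V h `<=` lattice V g, ord V (\det h) = ord V (\det g) + r%:Z &
    lattice V g e /\ forall y, lattice V g y ->
      exists2 a, a \in O & lattice V h (y - a *: e)].
Proof.
move=> r_gt0 gU CE [v [v0 vr edge ntri]].
have escape g1 g2 : g1 \in unitmx -> g2 \in unitmx ->
    ord V (\det g2) = ord V (\det g1) + 1 ->
    exists2 x, lattice V g1 x & ~ lattice V g2 x.
  move=> g1U g2U o12; apply: contrapT => H.
  suff /(lattice_det_le g1U g2U) : lattice V g1 `<=` lattice V g2.
    by rewrite o12 gerDl.
  by move=> x g1x; apply: contrapT => g2x; apply: H; exists x.
suff H n : (n < r)%N -> exists g1 g2 e, [/\ g1 \in unitmx, g2 \in unitmx,
    v n = homothety_class (lattice V g1), v n.+1 = homothety_class (lattice V g2)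
    & [/\ lattice V g2 `<=` lattice V g1, scale pi (lattice V g1) `<=` lattice V g2,
    ord V (\det g2) = ord V (\det g1) + 1,
    lattice V g1 `<=` lattice V g &
    [/\ ord V (\det g2) = ord V (\det g) + n.+1%:Z,
    lattice V g e, lattice V g1 (pi ^+ n *: e), ~ lattice V g2 (pi ^+ n *: e) &
    forall y, lattice V g y -> exists2 a, a \in O & lattice V g2 (y - a *: e)]]].
  have r1 : (r.-1 < r)%N by rewrite prednK.
  have [g1 [g2 [e [_ g2U _ v2 [S _ _ S' [o ge _ _ cov]]]]]] := H _ r1.
  rewrite prednK // in v2 o; exists g2, e; split=> //; first by rewrite -vr.
  exact: subset_trans S'.
elim: n => [|n IH] nr.
  have [E1 E2] := edge _ nr; rewrite -v0 in CE.
  have [h [hU DE hg gh o]] := edge_sublattice gU CE E1 E2.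
  have [e ge he] := escape _ _ gU hU o.
  exists g, h, e; split=> //; split=> //; split; rewrite ?scale1r //.
  by move=> y gy; apply: maximal_sublattice gy.
have [g1 [g2 [e [g1U g2U v1 v2 [S21 S12 o12 S1 [o ge g1e g2e cov]]]]]] := IH (ltnW nr).
have [E1 E2] := edge _ nr.
have [g3 [g3U v3 S32 S23 o23]] := edge_sublattice g2U v2 E1 E2.
have [nback ntriangle] := ntri n nr.
have g2pe : lattice V g2 (pi ^+ n.+1 *: e).
  by apply: S12; exists (pi ^+ n *: e) => //; rewrite scalerA -exprS.
(* Otherwise the class of [g3] is either that of [g1], a backtrack, or adjacent to it, which gives a
   triangle. *)
have not13 : ~ scale pi (lattice V g1) `<=` lattice V g3.
  move=> S13; apply: ntriangle.
  have [/building_pairP[vn vn1 a1] _] := edge _ (ltnW nr).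
  have /building_pairP[_ vn2 a2] := E1.
  apply/building_tripleP => //; split=> //; split; first by move/esym.
  exists (lattice V g1), (lattice V g3); rewrite v1 v3.
  split; [exact: homothety_class_id|exact: homothety_class_id| |].
    split=> // S31; apply: nback; rewrite v1 v3.
    rewrite -(homothety_class_scale (lattice V g1) (unif_neq0 V)).
    by congr homothety_class; apply/seteqP.
  split; first exact: subset_trans S21.
  move=> S; have [x g1x g2x] := escape _ _ g1U g2U o12.
  exact/g2x/S32/S.
have g3pe : ~ lattice V g3 (pi ^+ n.+1 *: e).
  move=> g3pe; apply: not13 => _ [x g1x <-].
  have [a aO g2xa] := maximal_sublattice g1U g2U S21 S12 o12 g1e g2e g1x.
  rewrite -[x](subrK (a *: (pi ^+ n *: e))) scalerDr; apply: latticeD.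
    by apply: S23; exists (x - a *: (pi ^+ n *: e)).
  by rewrite scalerA mulrC -scalerA [pi *: _]scalerA -exprS; apply: lattice_scalar.
exists g2, g3, e; split=> //; split=> //; first exact: subset_trans S1.
split=> //; first by rewrite o23 o; lia.
move=> y /cov[a aO g2y].
have [b bO g3y] := maximal_sublattice g2U g3U S32 S23 o23 g2pe g3pe g2y.
exists (a + b * pi ^+ n.+1); first by rewrite rpredD ?rpredM ?integral_unifX.
by rewrite scalerDl opprD addrA -scalerA.
Qed.

End Geodesics.

(** * Reduction modulo a power of the uniformizer *)

Section Reduction.
Local Open Scope ring_scope.
Local Open Scope classical_set_scope.
Local Open Scope quotient_scope.
Variables (F : fieldType) (V : valuation F) (r : nat) (r_gt0 : (0 < r)%N).
Local Notation pi := (unif V).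
Local Notation A := (quot_integers V r_gt0).

Definition red : {rmorphism integers V -> A} := \pi_A.

Lemma red_surj a : exists x, red x = a.
Proof. by exists (repr a); exact: (@reprK _ A a). Qed.

Definition int_unif : integers V := Integer (integral_unif V).

Lemma red_eq0 x : red x = 0 <-> exists y, x = int_unif ^+ r * y.
Proof.
have -> : red x = 0 <-> x \in unif_ideal r_gt0.
  rewrite -[x in x \in _]subr0 Quotient.idealrBE -[0 in X in X <-> _](rmorph0 red).
  by split=> [e|/eqP e]; [apply/eqP|].
have r0 : pi ^+ r != 0 by apply: unifX_neq0.
split=> [xI|[y ->]].
  exists (Integer xI); apply: val_inj; rewrite rmorphM rmorphXn /=.
  by rewrite mulrC mulfVK.
have e : int_val (int_unif ^+ r * y) = pi ^+ r * val y.
  have -> : int_val (int_unif ^+ r * y) = val (int_unif ^+ r * y) by [].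
  by rewrite rmorphM rmorphXn.
rewrite -[_ \in _]/(int_val (int_unif ^+ r * y) / pi ^+ r \in integral V) e.
by rewrite mulrAC mulfV // mul1r; exact: valP.
Qed.

Lemma integers_local (x : integers V) :
  (exists y, x * y = 1) \/ exists y, x = int_unif * y.
Proof.
have [x0|x0] := eqVneq (val x) 0.
  by right; exists 0; apply: val_inj; rewrite mulr0 x0 rmorph0.
have := valP x; rewrite integral_ord // => ox.
have [o0|o0] := eqVneq (ord V (val x)) 0.
  left; have xV : (val x)^-1 \in integral V.
    by rewrite integral_ord ?invr_eq0 // ordV // o0 oppr0.
  by exists (Integer xV); apply: val_inj; rewrite rmorphM rmorph1 /= mulfV.
right; have xp : val x / pi \in integral V.
  rewrite integral_ord ?mulf_neq0 ?invr_eq0 ?unif_neq0 //.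
  rewrite ordM ?invr_eq0 ?unif_neq0 // ordV ?unif_neq0 // ord_unif; lia.
exists (Integer xp); apply: val_inj; rewrite rmorphM /=.
by rewrite mulrC mulfVK ?unif_neq0.
Qed.

(** A nonunit lifts to a multiple of [pi], hence is killed by [pi ^+ r.-1] modulo [pi ^+ r]. For
    [r = 1] that factor is 1 and [A] is a field. *)
Lemma red_unif_socle (a : A) : (exists b, a * b = 1) \/ red int_unif ^+ r.-1 * a = 0.
Proof.
have [x <-] := red_surj a; have [[y xy]|[y ->]] := integers_local x.
  by left; exists (red y); rewrite -rmorphM xy rmorph1.
right; rewrite -rmorphXn -rmorphM; apply/red_eq0; exists y.
by rewrite mulrA -exprSr prednK.
Qed.

Lemma red_unif_neq0 : red int_unif ^+ r.-1 != 0.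
Proof.
apply/eqP; rewrite -rmorphXn => /red_eq0[y e].
have := congr1 val e; rewrite rmorphM !rmorphXn /= => e'.
have y0 : val y != 0.
  by apply: contraTneq (unifX_neq0 V r.-1) => y0; rewrite e' y0 mulr0 eqxx.
have := congr1 (ord V) e'; rewrite ordM ?unifX_neq0 // !ord_unifX.
have := valP y; rewrite integral_ord // -[val y]/(int_val y); lia.
Qed.

Lemma red_unit x : (exists b, red x * b = 1) -> exists y, x * y = 1.
Proof.
move=> [b xb]; have [//|[y xE]] := integers_local x.
have : red int_unif ^+ r.-1 * red x = 0.
  rewrite -rmorphXn -rmorphM; apply/red_eq0; exists y.
  by rewrite xE mulrA -exprSr prednK.
move/(congr1 (fun z => z * b)); rewrite -mulrA xb mulr1 mul0r => /eqP.
by rewrite (negPf red_unif_neq0).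
Qed.

Lemma red_mx_surj a b (M : 'M[A]_(a, b)) : exists N, map_mx red N = M.
Proof.
have [f fE] := choice red_surj.
by exists (map_mx f M); apply/matrixP => i j; rewrite !mxE fE.
Qed.

Lemma red_mx_eq0 a b (N : 'M_(a, b)) :
  map_mx red N = 0 <-> exists N', N = int_unif ^+ r *: N'.
Proof.
split=> [N0|[N' ->]]; last first.
  apply/matrixP=> i j; rewrite !mxE; apply/red_eq0; by exists (N' i j).
have H i j : exists y, N i j = int_unif ^+ r * y.
  by apply/red_eq0; move/matrixP/(_ i j): N0; rewrite !mxE.
have [f fE] := choice (fun p : 'I_a * 'I_b => H p.1 p.2).
by exists (\matrix_(i, j) f (i, j)); apply/matrixP=> i j; rewrite !mxE -fE.
Qed.

(** A determinant that is a unit modulo [pi ^+ r] is a unit, and the adjugate then supplies the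
    inverse. *)
Lemma red_invertible n (k : 'M[integers V]_n) :
  invertible (map_mx red k) -> invertible k.
Proof.
move=> [M kM]; have [N NE] := red_mx_surj M.
have [|y dy] := red_unit (x := \det k).
  by exists (\det M); rewrite -det_map_mx -det_mulmx kM det1.
by exists (y *: \adj k); rewrite -scalemxAr mul_mx_adj scale_scalar_mx mulrC dy.
Qed.

Lemma integral_mxP a b (x : 'M[F]_(a, b)) :
  x \is a mxOver (integral V) <-> exists y, x = map_mx val (y : 'M[integers V]_(a, b)).
Proof.
split=> [/mxOverP xO|[y ->]].
  by exists (\matrix_(i, j) Integer (xO i j)); apply/matrixP => i j; rewrite !mxE.
by apply/mxOverP=> i j; rewrite mxE; exact: valP.
Qed.

Lemma map_val_inj a b (x y : 'M[integers V]_(a, b)) :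
  map_mx val x = map_mx val y -> x = y.
Proof.
by move/matrixP=> e; apply/matrixP=> i j; have := e i j; rewrite !mxE => /val_inj.
Qed.

End Reduction.

(** * Lattices diagonal in a fixed basis *)

Section DiagonalLattices.
Local Open Scope ring_scope.
Local Open Scope classical_set_scope.
Variables (F : fieldType) (V : valuation F) (d : nat) (d_gt1 : (1 < d)%N).
Local Notation pi := (unif V).
Local Notation O := (integral V).
Variables (h : 'M[F]_d) (hU : h \in unitmx).
Implicit Type eps : 'I_d -> nat.

Definition diag_basis eps : 'M[F]_d := h *m diag_mx (\row_q pi ^+ eps q).

Definition diag_lattice eps := lattice V (diag_basis eps).

Lemma diag_basis_unitmx eps : diag_basis eps \in unitmx.
Proof.
rewrite unitmx_mul hU unitmxE det_diag unitfE; apply/prodf_neq0 => q _.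
by rewrite mxE unifX_neq0.
Qed.

Lemma ord_det_diag_basis eps : ord V (\det (diag_basis eps)) =
  ord V (\det h) + \sum_q (eps q)%:Z.
Proof.
rewrite det_mulmx det_diag; under eq_bigr do rewrite mxE.
rewrite -expr_sum ordM ?unifX_neq0 ?(det_neq0 hU) // ord_unifX.
by rewrite -natz natr_sum; congr (_ + _); apply: eq_bigr => q _; rewrite natz.
Qed.

Lemma diag_latticeP eps x : diag_lattice eps x <->
  forall q, (invmx h *m x) q 0 / pi ^+ eps q \in O.
Proof.
split=> [[y /mxOverP yO <-] q|H].
  by rewrite -mulmxA mulKmx // mul_diag_mx !mxE mulrAC mulfV ?unifX_neq0 // mul1r.
exists (\col_q ((invmx h *m x) q 0 / pi ^+ eps q)).
  by apply/mxOverP=> q j; rewrite mxE.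
rewrite -mulmxA -[RHS](mulKVmx hU); congr (_ *m _).
apply/matrixP=> q j; by rewrite ord1 mul_diag_mx !mxE mulrC mulfVK ?unifX_neq0 //.
Qed.

Lemma diag_lattice_sub c eps eps' : c != 0 ->
  scale c (diag_lattice eps) `<=` diag_lattice eps' <->
  forall q, (eps' q)%:Z <= ord V c + (eps q)%:Z.
Proof.
move=> c0.
have E q : (c * pi ^+ eps q / pi ^+ eps' q \in O) =
    ((eps' q)%:Z <= ord V c + (eps q)%:Z).
  rewrite integral_ord ?mulf_neq0 ?invr_eq0 ?unifX_neq0 //.
  rewrite !ordM ?mulf_neq0 ?invr_eq0 ?unifX_neq0 // ordV ?unifX_neq0 //.
  by rewrite !ord_unifX subr_ge0.
split=> [S q|H _ [x /diag_latticeP xE <-]].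
  rewrite -E; pose x : 'cV[F]_d := h *m (pi ^+ eps q *: delta_mx q 0).
  have /S/diag_latticeP/(_ q) : scale c (diag_lattice eps) (c *: x).
    exists x => //; apply/diag_latticeP => q'; rewrite mulKmx // !mxE.
    have [->|_] := eqVneq q' q; first by rewrite mulr1 mulfV ?unifX_neq0 ?rpred1.
    by rewrite mulr0 mul0r rpred0.
  by rewrite -scalemxAr mulKmx // !mxE !eqxx mulr1.
apply/diag_latticeP => q; rewrite -scalemxAr mxE.
have -> : c * (invmx h *m x) q 0 / pi ^+ eps' q =
    (c * pi ^+ eps q / pi ^+ eps' q) * ((invmx h *m x) q 0 / pi ^+ eps q).
  by field; rewrite !unifX_neq0.
by rewrite rpredM // E.
Qed.

Lemma diag_latticeS eps eps' :
  diag_lattice eps `<=` diag_lattice eps' <-> forall q, (eps' q <= eps q)%N.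
Proof.
rewrite -(scale1 (diag_lattice eps)) (diag_lattice_sub _ _ (oner_neq0 F)).
by rewrite Defs.ord1; split=> H q; have := H q; lia.
Qed.

Lemma building_vertex_diag eps :
  building_vertex V (homothety_class (diag_lattice eps)).
Proof.
exists (diag_lattice eps) => //; exists (diag_basis eps) => //.
exact: diag_basis_unitmx.
Qed.

(** The exponents of the lattice generated by the first [i] basis vectors and [pi ^+ r] times the
    others, the preimage of a free module of rank [i] modulo [pi ^+ r]. *)
Definition step_exponents r i (q : 'I_d) : nat := if (q < i)%N then 0 else r.

(* The path increases the exponent at [i] from [0] to [r]. *)
Lemma geodesic_diag r (i : 'I_d) : geodesic V r
  (homothety_class (diag_lattice (step_exponents r i.+1)))
  (homothety_class (diag_lattice (step_exponents r i))).
Proof.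
pose eta t (q : 'I_d) := if q == i then t else step_exponents r i q.
have etai t : eta t i = t by rewrite /eta eqxx.
(* A coordinate whose exponent is constant along the path; together with [i] it constrains the
   valuation of any homothety factor. *)
have [p pi_neq] : exists p, p != i.
  have [i0|i0] := eqVneq (i : nat) 0%N.
    by exists (Ordinal d_gt1); rewrite -val_eqE /= i0.
  by exists (Ordinal (ltnW d_gt1)); rewrite -val_eqE /= eq_sym.
have etap t : eta t p = step_exponents r i p by rewrite /eta (negPf pi_neq).
exists (fun t => homothety_class (diag_lattice (eta t))); split.
- congr (homothety_class (diag_lattice _)); apply/funext=> q.
  rewrite /eta /step_exponents ltnS.
  have [->|qi] := eqVneq q i; first by rewrite leqnn.
  by rewrite [in RHS]leq_eqVlt (_ : (q == i :> nat) = false) //; apply: negbTE.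
- congr (homothety_class (diag_lattice _)); apply/funext=> q.
  by rewrite /eta /step_exponents; case: eqP => // ->; rewrite ltnn.
- move=> t tr; split.
    apply/building_pairP; split; try exact: building_vertex_diag.
    split.
      move=> e; have : homothety_class (diag_lattice (eta t.+1)) (diag_lattice (eta t)).
        by rewrite -e; exact: homothety_class_id.
      case=> c c0 E; have S1 : scale c (diag_lattice (eta t.+1)) `<=`
        diag_lattice (eta t) by rewrite E.
      have S2 : scale c^-1 (diag_lattice (eta t)) `<=` diag_lattice (eta t.+1).
        by rewrite -E scaleM mulVf // scale1.
      have /(_ p) := (diag_lattice_sub _ _ c0).1 S1.
      have /(_ i) := (diag_lattice_sub _ _ (invr_neq0 c0)).1 S2.
      by rewrite !etai !etap ordV //; lia.
    exists (diag_lattice (eta t)), (diag_lattice (eta t.+1)); split;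
      try exact: homothety_class_id.
      split; first apply/(diag_lattice_sub _ _ (unif_neq0 V)) => q.
        by rewrite ord_unif /eta; case: eqP => _; lia.
      move/(scale_sub _ _ (invr_neq0 (unif_neq0 V))).
      rewrite scaleM mulVf ?unif_neq0 // scale1.
      move/(diag_lattice_sub _ _ (invr_neq0 (unif_neq0 V)))/(_ p).
      by rewrite !etap ordV ?unif_neq0 // ord_unif; lia.
    split; first by apply/diag_latticeS => q; rewrite /eta; case: eqP => //.
    by move=> /diag_latticeS/(_ i); rewrite !etai ltnn.
  rewrite /edge_color !vertex_color_class ?diag_basis_unitmx // -intrB.
  rewrite !ord_det_diag_basis (bigD1 i) //= [in X in _ - X](bigD1 i) //= !etai.
  rewrite (eq_bigr (fun q => (eta t q)%:Z)) => [|q qi].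
    by rewrite (_ : _ - _ = 1) //; lia.
  by rewrite /eta (negPf qi).
- move=> t tr.
  (* At [i] the first inclusion gives [ord V c <= -1], at [p] the second gives [ord V c >= 0]. This
     excludes backtracks and triangles alike. *)
  have no c : c != 0 -> scale pi (diag_lattice (eta t)) `<=`
      scale c (diag_lattice (eta t.+2)) ->
      scale c (diag_lattice (eta t.+2)) `<=` diag_lattice (eta t) -> False.
    move=> c0 S1 /(diag_lattice_sub _ _ c0)/(_ p).
    have : scale (c^-1 * pi) (diag_lattice (eta t)) `<=` diag_lattice (eta t.+2).
      by rewrite -scaleM -[X in _ `<=` X]scale1 -(mulVf c0) -scaleM scale_sub
        ?invr_neq0.
    move/(diag_lattice_sub _ _ (mulf_neq0 (invr_neq0 c0) (unif_neq0 V)))/(_ i).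
    rewrite !etai !etap ordM ?invr_neq0 ?unif_neq0 // ordV // ord_unif; lia.
  split.
    move=> e; have : homothety_class (diag_lattice (eta t.+2)) (diag_lattice (eta t)).
      by rewrite e; exact: homothety_class_id.
    case=> c c0 E; apply: (no c c0); rewrite E //.
    apply/(diag_lattice_sub _ _ (unif_neq0 V)) => q; rewrite ord_unif; lia.
  move=> /(building_tripleP (building_vertex_diag _) (building_vertex_diag _)
    (building_vertex_diag _))[_ _ [_ [_ [_ [[a a0 <-] [b b0 <-] [S1 _] [S2 _]]]]]].
  have ab0 : a^-1 * b != 0 by rewrite mulf_neq0 ?invr_eq0.
  apply: (no _ ab0); apply/(scale_sub _ _ a0); rewrite !scaleM mulrA mulfV // mul1r //.
  by rewrite mulrC -scaleM.
Qed.

End DiagonalLattices.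

(** * The star of a vertex *)

Section LatticeChart.
Local Open Scope ring_scope.
Local Open Scope classical_set_scope.
Variables (F : fieldType) (V : valuation F) (r : nat) (r_gt0 : (0 < r)%N).
Variable m : nat.
Local Notation d := m.+1.
Local Notation pi := (unif V).
Local Notation A := (quot_integers V r_gt0).
Local Notation red := (red V r_gt0).
Local Notation piO := (int_unif V).
Variables (g : 'M[F]_d) (gU : g \in unitmx).

(** The correspondence between submodules of [L / pi ^+ r L] and lattices from [pi ^+ r L] to [L],
    for [L = lattice V g], in the coordinates given by [g]. *)
Definition lift_lattice (M : set 'cV[A]_d) : set 'cV[F]_d :=
  [set g *m map_mx val x | x in [set x : 'cV[integers V]_d | M (map_mx red x)]].

Lemma lift_latticeP M x :
  lift_lattice M (g *m map_mx val x) <-> M (map_mx red x).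
Proof.
split=> [[y My e]|]; last by exists x.
by have /map_val_inj <- := can_inj (mulKmx gU) e.
Qed.

Lemma lift_lattice_inj : injective lift_lattice.
Proof.
move=> M N e; apply/seteqP; split=> z; have [x <-] := red_mx_surj z;
  by move=> /lift_latticeP; rewrite (e, =^~ e) => /lift_latticeP.
Qed.

Lemma lift_lattice_sub M N : M `<=` N -> lift_lattice M `<=` lift_lattice N.
Proof. by move=> MN _ [x /MN Nx <-]; apply/lift_latticeP. Qed.

Lemma in_lattice x : lattice V g (g *m map_mx val (x : 'cV[integers V]_d)).
Proof. by exists (map_mx val x) => //; apply/integral_mxP; exists x. Qed.

Lemma lift_latticeT : lift_lattice setT = lattice V g.
Proof.
apply/seteqP; split=> [_ [x _ <-]|_ [_ /integral_mxP[x ->] <-]].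
  exact: in_lattice.
by exists x.
Qed.

Lemma map_valZ n (x : 'cV[integers V]_n) :
  map_mx val (piO ^+ r *: x) = pi ^+ r *: map_mx val x.
Proof. by apply/matrixP=> i j; rewrite !mxE rmorphM rmorphXn. Qed.

Lemma lift_lattice0 : lift_lattice [set 0] = scale (pi ^+ r) (lattice V g).
Proof.
apply/seteqP; split=> [_ [x /red_mx_eq0[y ->] <-]|_ [_ [_ /integral_mxP[x ->] <-] <-]].
  rewrite map_valZ -scalemxAr; exists (g *m map_mx val y) => //.
  exact: in_lattice.
exists (piO ^+ r *: x); last by rewrite map_valZ scalemxAr.
by apply/red_mx_eq0; exists x.
Qed.

(* The ranks [0] and [d] both give the class of [lattice V g]. *)
Definition chart k i := homothety_class (lift_lattice (col_span k i)).

Lemma chart0 k : chart k 0 = homothety_class (lattice V g).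
Proof.
by rewrite /chart col_span0 lift_lattice0 homothety_class_scale ?unifX_neq0.
Qed.

Lemma chart_full k : invertible k -> chart k d = homothety_class (lattice V g).
Proof. by move=> kI; rewrite /chart col_span_full // lift_latticeT. Qed.

Lemma latticeZ_sub a b : a != 0 -> b != 0 -> ord V b <= ord V a ->
  scale a (lattice V g) `<=` scale b (lattice V g).
Proof.
move=> a0 b0 ab; have -> : a = b * (a / b) by rewrite mulrC mulfVK.
rewrite -scaleM; apply/(scale_sub _ _ b0) => _ [x gx <-].
apply: lattice_scalar => //; rewrite integral_ord ?mulf_neq0 ?invr_eq0 //.
by rewrite ordM ?invr_eq0 // ordV // subr_ge0.
Qed.

(** The first column of an invertible matrix is not divisible by [pi]: otherwise [pi ^+ r.-1] would
    kill it modulo [pi ^+ r], hence also a basis vector. *)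
Lemma col_span_primitive k i c : invertible k -> (0 < i)%N -> c != 0 ->
  lift_lattice (col_span k i) `<=` scale c (lattice V g) -> ord V c <= 0.
Proof.
move=> [k' kk'] i0 c0 S; rewrite leNgt; apply/negP => oc.
have [x xE] := red_mx_surj (k *m (delta_mx 0 0 : 'cV_d)).
have : scale c (lattice V g) (g *m map_mx val x).
  apply: S; apply/lift_latticeP; rewrite xE; exists (delta_mx 0 0) => //.
  exact: std_span_delta.
move=> /(@latticeZ_sub c pi c0 (unif_neq0 V)).
rewrite ord_unif => /(_ oc)[_ [_ /integral_mxP[y ->] <-] e].
have xy : x = piO *: y.
  apply: (@map_val_inj _ V); apply: (can_inj (mulKmx gU)); rewrite -e scalemxAr.
  by congr (_ *m _); apply/matrixP=> a b; rewrite !mxE rmorphM.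
have /(red_mx_eq0 r_gt0) : exists z, piO ^+ r.-1 *: x = piO ^+ r *: z.
  by exists y; rewrite xy scalerA -exprSr prednK.
rewrite map_mxZ xE scalemxAr => e0.
have := congr1 (mulmx k') e0; rewrite mulmxA (mulmx1C kk') mul1mx mulmx0.
move/matrixP/(_ 0 0); rewrite !mxE !eqxx mulr1 rmorphXn => /eqP.
by rewrite (negPf (red_unif_neq0 _ _)).
Qed.

Lemma chart_neq0 k k' j : invertible k' -> (0 < j < d)%N ->
  chart k 0 <> chart k' j.
Proof.
move=> k'I /andP[j0 jd] e.
have : homothety_class (lift_lattice (col_span k' j)) (lattice V g).
  by rewrite -[homothety_class _]/(chart k' j) -e chart0; exact: homothety_class_id.
case=> c c0 E.
have E' : lift_lattice (col_span k' j) = scale c^-1 (lattice V g).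
  by rewrite -E scaleM mulVf // scale1.
have oc : ord V c^-1 <= 0.
  by apply: (@col_span_primitive k' j) => //; rewrite ?invr_eq0 ?E'.
have S : lift_lattice setT `<=` lift_lattice (col_span k' j).
  rewrite lift_latticeT E' -{1}(scale1 (lattice V g)).
  by apply: latticeZ_sub; rewrite ?oner_neq0 ?invr_eq0 // Defs.ord1.
have : col_span k' d `<=` col_span k' j.
  move=> z _; have [x <-] := red_mx_surj z; apply/lift_latticeP/S.
  exact/lift_latticeP.
move/(col_span_refine (red_unif_neq0 V r_gt0) (@red_unif_socle F V r r_gt0)
  (ltnW jd) (leqnn _) k'I k'I) => -[].
by rewrite leqNgt jd.
Qed.

(** In positive rank, [col_span_primitive] applied in both directions leaves only homothety factors
    of valuation 0, and these stabilize every lifted module. Rank 0 is separated from the others by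
    [chart_neq0]. *)
Lemma chart_eq k k' i j : invertible k -> invertible k' -> (i < d)%N ->
  (j < d)%N -> chart k i = chart k' j <-> col_span k i = col_span k' j.
Proof.
move=> kI k'I id jd; split; last by rewrite /chart => ->.
have [->|i0] := posnP i; have [->|j0] := posnP j.
- by rewrite !col_span0.
- by move/chart_neq0; case=> //; rewrite j0.
- by move/esym/chart_neq0; case=> //; rewrite i0.
move=> e; apply: lift_lattice_inj.
have : homothety_class (lift_lattice (col_span k i)) (lift_lattice (col_span k' j)).
  by rewrite -[homothety_class _]/(chart k i) e; exact: homothety_class_id.
have sub n l : lift_lattice (col_span n l) `<=` lattice V g.
  by rewrite -lift_latticeT; apply: lift_lattice_sub.
case=> c c0 E; have c'0 : c^-1 != 0 by rewrite invr_eq0.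
have E' : lift_lattice (col_span k i) = scale c^-1 (lift_lattice (col_span k' j)).
  by rewrite -E scaleM mulVf // scale1.
have oc : ord V c = 0.
  have o1 : ord V c <= 0.
    apply: (@col_span_primitive k' j) => //; rewrite -E.
    exact/(scale_sub _ _ c0)/sub.
  have o2 : ord V c^-1 <= 0.
    apply: (@col_span_primitive k i) => //; rewrite E'.
    exact/(scale_sub _ _ c'0)/sub.
  by rewrite ordV // in o2; lia.
have stable n l a : a \in integral V ->
    scale a (lift_lattice (col_span n l)) `<=` lift_lattice (col_span n l).
  move=> aO _ [_ [x [z lz zE] <-] <-]; pose b := Integer aO.
  have -> : a *: (g *m map_mx val x) = g *m map_mx val (b *: x).
    by rewrite scalemxAr; congr (_ *m _); apply/matrixP=> p q; rewrite !mxE rmorphM.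
  apply/lift_latticeP; rewrite map_mxZ -zE scalemxAr.
  exists (red b *: z) => // p lp; by rewrite mxE lz // mulr0.
apply/seteqP; split.
  by rewrite E'; apply: stable; rewrite integral_ord // ordV // oc oppr0.
by rewrite -E; apply: stable; rewrite integral_ord // oc.
Qed.

(** The lift [k] is itself invertible, so its columns give a basis of [lattice V g] adapted to all
    ranks of the flag at once. *)
Lemma lift_lattice_diag (k : 'M[integers V]_d) i : invertible (map_mx red k) ->
  lift_lattice (col_span (map_mx red k) i) =
  diag_lattice V (g *m map_mx val k) (step_exponents r i).
Proof.
move=> /red_invertible[k' kk'].
have kU : g *m map_mx val k \in unitmx.
  rewrite unitmx_mul gU /=.
  have := congr1 (map_mx val) kk'; rewrite map_mxM map_mx1.
  by move/mulmx1_unit => [].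
have stepE (y : 'cV[integers V]_d) : map_mx val
    (\col_q (if (q < i)%N then y q 0 else piO ^+ r * y q 0)) =
    diag_mx (\row_q pi ^+ step_exponents r i q) *m map_mx val y.
  apply/matrixP=> q j; rewrite ord1 mul_diag_mx !mxE /step_exponents.
  by case: ifP => _; rewrite ?expr0 ?mul1r // rmorphM rmorphXn.
apply/seteqP; split=> [_ [x [z iz e] <-]|_ [_ /integral_mxP[y ->] <-]]; last first.
  rewrite /diag_basis -mulmxA -stepE -mulmxA -map_mxM; apply/lift_latticeP.
  rewrite map_mxM; eexists; last by [].
  move=> q iq; rewrite !mxE ltnNge iq /=; apply/red_eq0; by exists (y q 0).
pose y := k' *m x.
have xE : x = k *m y by rewrite mulmxA kk' mul1mx.
have yz : map_mx red y = z.
  rewrite map_mxM -e mulmxA -map_mxM (mulmx1C kk') map_mx1 mul1mx //.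
have [w wE] : exists w : 'cV_d,
    y = \col_q (if (q < i)%N then w q 0 else piO ^+ r * w q 0).
  have H q : exists w, y q 0 = if (q < i)%N then w else piO ^+ r * w.
    case: ltnP => [_|iq]; first by exists (y q 0).
    by apply/(red_eq0 r_gt0); move/matrixP/(_ q 0): yz; rewrite mxE => ->; apply: iz.
  have [w wE] := choice H; exists (\col_q w q).
  by apply/matrixP=> q j; rewrite ord1 [RHS]mxE wE mxE.
exists (map_mx val w); first by apply/integral_mxP; exists w.
by rewrite /diag_basis -mulmxA -stepE -wE -mulmxA -map_mxM -xE.
Qed.

End LatticeChart.

(** * Top cells through a vertex *)

Section TopCells.
Local Open Scope ring_scope.
Local Open Scope classical_set_scope.
Variables (F : fieldType) (V : valuation F) (r : nat) (r_gt0 : (0 < r)%N).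
Variables (m : nat) (d_gt1 : (1 < m.+1)%N).
Local Notation d := m.+1.
Local Notation pi := (unif V).
Local Notation A := (quot_integers V r_gt0).
Local Notation red := (red V r_gt0).
Variables (g : 'M[F]_d) (gU : g \in unitmx).
Local Notation chart := (chart (V := V) (r_gt0 := r_gt0) g).
Local Notation lift_lattice := (@lift_lattice F V r r_gt0 m g).

Lemma chart_top_cell k : invertible k ->
  power_top_cell V r (chart k @` [set i | (i < d)%N]).
Proof.
move=> kI; have [k' kE] := red_mx_surj k.
have cE i : chart k i =
    homothety_class (diag_lattice V (g *m map_mx val k') (step_exponents r i)).
  by rewrite /chart -lift_lattice_diag ?kE.
have kU : g *m map_mx val k' \in unitmx.
  rewrite unitmx_mul gU /=; rewrite -kE in kI.
  have [k'' /(congr1 (map_mx val))] := red_invertible kI.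
  by rewrite map_mxM map_mx1 => /mulmx1_unit[].
have geo (i : nat) : (i < d)%N -> geodesic V r (chart k i.+1) (chart k i).
  move=> id; rewrite !cE. exact: (geodesic_diag V d_gt1 kU r (Ordinal id)).
(* Geodesics lower the rank, so position [j] carries rank [d - j]. Rank [d] at [j = 0] is renamed 0,
   which names the same vertex and is below [d]. *)
pose u (j : 'I_d) := if j == 0 then 0%N else (d - j)%N.
have ud j : (u j < d)%N by rewrite /u; case: eqVneq => // j0; have := ltn_ord j;
  have : (j != 0 :> nat) by []; lia.
have uE j : chart k (u j) = chart k (d - j).
  rewrite /u; case: eqVneq => // ->.
  by rewrite subn0 chart_full // chart0.
exists (fun j => chart k (u j)); split.
- move=> j j' /(chart_eq gU kI kI (ud j) (ud j')).
  move/(col_span_rank (red_unif_neq0 V r_gt0) (@red_unif_socle F V r r_gt0)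
    (ltnW (ud j)) (ltnW (ud j')) kI kI).
  rewrite /u => e; apply: val_inj; move: e.
  have := ltn_ord j; have := ltn_ord j'.
  by rewrite -!val_eqE /=; do 2!case: eqP => /=; lia.
- by move=> j; rewrite cE; exact: building_vertex_diag.
- move=> j; rewrite uE.
  have -> : chart k (u (ordS j)) = chart k (d - j.+1).
    have [jd|jd] := ltnP j.+1 d.
      by rewrite uE /= modn_small.
    have jE : j.+1 = d by apply/eqP; rewrite eqn_leq jd ltn_ord.
    by rewrite /u -val_eqE /= jE modnn subnn.
  by rewrite -subnSK //; apply: geo; have := ltn_ord j; lia.
apply/seteqP; split=> [_ [i /= id <-]|_ [j _ <-]]; last by exists (u j) => //=.
have [->|i0] := posnP i; first by exists 0.
have di : (d - i < d)%N by lia.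
exists (Ordinal di) => //=; congr chart; rewrite /u -val_eqE /=.
by case: eqP; lia.
Qed.

(** After one turn around the cell the class is the initial one, and the valuation of the
    determinant has grown by [d * r], which forces [G d] to be [pi ^+ r] times the lattice. The
    quotients are only known to be cyclic: [k] is invertible because its [d] columns generate
    everything. *)
Lemma top_cell_chart s : power_top_cell V r s -> s (homothety_class (lattice V g)) ->
  exists2 k, invertible k & s `<=` chart k @` [set i | (i < d)%N].
Proof.
move=> [w [winj wV wG ->]] [i0 _ i0E].
pose u n := w (iter n (@ordS d) i0).
have iterE n : iter n (@ordS d) i0 = ((i0 + n) %% d)%N :> nat.
  elim: n => [|n IH]; first by rewrite addn0 modn_small.
  by rewrite iterS /= IH -addn1 modnDml addn1 addnS.
have u0 : u 0%N = homothety_class (lattice V g) by [].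
have ud : u d = u 0%N.
  rewrite /u; congr w; apply: ord_inj.
  by rewrite [LHS]iterE modnDr modn_small.
have uG n : geodesic V r (u n) (u n.+1) by exact: wG.
(* The premises on [p] are part of the relation, so that every pair has a successor, possibly a
   dummy one, and [choice] applies. *)
pose step (p : nat * 'M[F]_d) (q : 'M[F]_d * 'cV[F]_d) :=
  p.2 \in unitmx -> u p.1 = homothety_class (lattice V p.2) ->
    [/\ q.1 \in unitmx, u p.1.+1 = homothety_class (lattice V q.1),
      lattice V q.1 `<=` lattice V p.2,
      ord V (\det q.1) = ord V (\det p.2) + r%:Z &
      lattice V p.2 q.2 /\ forall y, lattice V p.2 y ->
        exists2 a, a \in integral V & lattice V q.1 (y - a *: q.2)].
have /choice[f fP] p : exists q, step p q.
  case: p => n M; rewrite /step /=.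
  have [MU|] := pselect (M \in unitmx /\ u n = homothety_class (lattice V M)).
    have [h [e H]] := geodesic_cyclic d_gt1 r_gt0 MU.1 MU.2 (uG n).
    by exists (h, e).
  by move=> H; exists (M, 0) => MU Mu; case: H.
pose fix G n := if n is n'.+1 then (f (n', G n')).1 else g.
pose e n := (f (n, G n)).2.
have GP n : G n \in unitmx /\ u n = homothety_class (lattice V (G n)).
  elim: n => [//|n [U E]].
  by have [] := fP (n, G n) U E.
have GS n : [/\ lattice V (G n.+1) `<=` lattice V (G n),
    ord V (\det (G n.+1)) = ord V (\det (G n)) + r%:Z,
    lattice V (G n) (e n) & forall y, lattice V (G n) y ->
      exists2 a, a \in integral V & lattice V (G n.+1) (y - a *: e n)].
  by have [_ _ S o [ge cov]] := fP (n, G n) (GP n).1 (GP n).2.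
have G0 : G 0%N = g by [].
clearbody e; clearbody G.
have Go n : ord V (\det (G n)) = ord V (\det g) + (n * r)%:Z.
  elim: n => [|n IH]; first by rewrite mul0n addr0 G0.
  have [_ -> _ _] := GS n.
  by rewrite IH mulSn; lia.
have Gsub n : lattice V (G n) `<=` lattice V g.
  elim: n => [|n IH]; first by rewrite G0.
  by have [S _ _ _] := GS n; exact: subset_trans IH.
have Gd : lattice V (G d) = scale (pi ^+ r) (lattice V g).
  have : homothety_class (lattice V g) (lattice V (G d)).
    by rewrite -u0 -ud (GP d).2; exact: homothety_class_id.
  case=> c c0 E.
  have oc : ord V c = r%:Z.
    have cU := scale_unitmx c0 gU; have [GU _] := GP d.
    have o1 : ord V (\det (G d)) = ord V (\det (c *: g)).
      by apply/eqP; rewrite eq_le !lattice_det_le // -latticeZ E.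
    move: o1; rewrite Go ord_detZ // -mulr_natl natz addrC.
    move/addIr; rewrite PoszM => e1; apply/esym.
    by apply: (mulfI _ e1).
  by rewrite -E; apply/seteqP; split; apply: latticeZ_sub;
    rewrite ?unifX_neq0 // ord_unifX oc.
have /choice[y yE] n : exists x : 'cV[integers V]_d, e n = g *m map_mx val x.
  have [_ _ /Gsub[x /integral_mxP[z ->] zE] _] := GS n.
  by exists z; rewrite zE.
(* The generator of the last quotient, of index [m = d - 1], comes first, so that rank [j]
   corresponds to [G (d - j)]. *)
pose k : 'M[A]_d := map_mx red (\matrix_(p, q) y (m - q)%N p 0).
have kcol (q : 'I_d) : k *m delta_mx q 0 = map_mx red (y (m - q)%N) :> 'cV_d.
  by rewrite -colE; apply/matrixP=> p j; rewrite !mxE ord1.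
have GE j : (j <= d)%N -> lattice V (G (d - j)%N) = lift_lattice (col_span k j).
  elim: j => [_|j IH jd]; first by rewrite subn0 Gd col_span0 lift_lattice0.
  have [] := GS (d - j.+1)%N; rewrite subnSK // => S _ ge cov.
  have yj : k *m delta_mx (Ordinal jd) 0 = map_mx red (y (d - j.+1)%N) :> 'cV_d.
    by rewrite kcol subSS.
  rewrite yE IH ?(ltnW jd) // in S ge cov.
  apply/seteqP; split=> [x Gx|_ [x [z jz xE] <-]].
    have [_ /integral_mxP[X ->] XE] := Gsub _ _ Gx.
    rewrite -XE in Gx *; have [a aO] := cov _ Gx.
    pose b : integers V := Integer aO.
    have -> : g *m map_mx val X - a *: (g *m map_mx val (y (d - j.+1)%N)) =
        g *m map_mx val (X - b *: y (d - j.+1)%N).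
      rewrite scalemxAr -mulmxBr; congr (_ *m _).
      by apply/matrixP=> p q; rewrite !mxE rmorphB rmorphM.
    move/(lift_latticeP gU) => [z jz zE]; apply/lift_latticeP => //.
    exists (z + red b *: delta_mx (Ordinal jd) 0).
      move=> p jp; rewrite !mxE jz ?(ltnW jp) // add0r.
      by case: eqP => [pE|_]; rewrite ?mulr0 //; rewrite pE /= ltnn in jp.
    rewrite mulmxDr -scalemxAr yj zE -map_mxZ -map_mxD; congr map_mx.
    by rewrite subrK.
  have [b bE] := red_surj (z (Ordinal jd) 0).
  rewrite -[x](subrK (b *: y (d - j.+1)%N)) map_mxD mulmxDr; apply: latticeD.
    apply: S; apply/lift_latticeP => //.
    exists (z - red b *: delta_mx (Ordinal jd) 0).
      move=> p jp; rewrite !mxE.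
      have [->|pj] := eqVneq p (Ordinal jd); first by rewrite eqxx mulr1 bE subrr.
      rewrite mulr0 subr0; apply: jz; rewrite ltn_neqAle jp andbT.
      by apply: contra pj => /eqP pj; apply/eqP/val_inj.
    by rewrite mulmxBr -scalemxAr yj xE -map_mxZ -map_mxB.
  have -> : map_mx val (b *: y (d - j.+1)%N) = val b *: map_mx val (y (d - j.+1)%N).
    by apply/matrixP=> p q; rewrite !mxE rmorphM.
  by rewrite -scalemxAr; apply: lattice_scalar => //; exact: valP.
clearbody k.
have kI : invertible k.
  have H (q : 'I_d) : exists x : 'cV_d, k *m x = delta_mx q 0.
    have [x xE] := red_mx_surj (delta_mx q 0 : 'cV[A]_d).
    have : lattice V g (g *m map_mx val x) by exact: in_lattice.
    have := GE d (leqnn d); rewrite subnn G0 => -> /(lift_latticeP gU)[z _ zE].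
    by exists z; rewrite -xE -zE.
  have [X XE] := choice H.
  exists (\matrix_(p, q) X q p 0); apply/matrixP=> p q.
  have /matrixP/(_ p 0) := XE q; rewrite !mxE andbT => <-.
  by apply: eq_bigr => l _; rewrite mxE.
exists k => // _ [i _ <-].
(* The number of steps from [i0] to [i] around the cell; the rank is [d - n], or 0 when [n = 0]. *)
pose n := ((i + (d - i0)) %% d)%N.
have nd : (n < d)%N by rewrite /n ltn_mod.
have -> : w i = u n.
  rewrite /u; congr w; apply: ord_inj; rewrite [RHS]iterE modnDmr addnCA.
  rewrite subnKC ?(ltnW (ltn_ord _)) //.
  by rewrite modnDr modn_small.
have [n0|n0] := posnP n; first by exists 0%N => //; rewrite n0 chart0 u0.
exists (d - n)%N; first by rewrite /=; lia.
by rewrite (GP n).2 /chart -GE ?leq_subr // subKn // ltnW.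
Qed.

Lemma vertex_star s : s (homothety_class (lattice V g)) ->
  geodesic_power V d r s <->
  exists2 k, invertible k & s `<=` chart k @` [set i | (i < d)%N].
Proof.
move=> sC; split=> [[[C _ sub]|[t tP st]]|[k kI sk]].
- exists 1%:M; first exact: invertible1.
  move=> x sx; exists 0%N => //; rewrite chart0.
  by rewrite (sub _ sx) (sub _ sC).
- by have [k kI tk] := top_cell_chart tP (st _ sC); exists k => // x /st/tk.
- by right; exists (chart k @` [set i | (i < d)%N]) => //; exact: chart_top_cell.
Qed.

End TopCells.

Lemma geodesic_power_vertex F (V : valuation F) d r C :
  vertices (geodesic_power V d r) C -> building_vertex V C.
Proof.
case=> [[C' vC' /(_ C erefl) ->//]|[t [v [_ vV _ ->]] /(_ C erefl)[i _ <-]]].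
exact: vV.
Qed.

Theorem proposition3p6 (F : fieldType) (V : valuation F)
  (V_local : nonarch_local_field V)
  (r : nat) (r_gt0 : (0 < r)%N) (d : nat) (d_gt1 : (1 < d)%N) :
  (forall C, vertices (geodesic_power V d r) C ->
     complex_iso (link (geodesic_power V d r) [set C]%classic)
                 (proj_free d.-1 (quot_integers V r_gt0))) /\
  ((2 < d)%N ->
     forall tau, dim_cells (geodesic_power V d r) (d - 3) tau ->
       complete_bipartite (link (geodesic_power V d r) tau) \/
       complex_iso (link (geodesic_power V d r) tau)
                   (proj_free 2 (quot_integers V r_gt0))).
Proof.
case: d d_gt1 => // m d_gt1.
have t0 := @red_unif_neq0 F V r r_gt0; have soc := @red_unif_socle F V r r_gt0.
split=> [C /geodesic_power_vertex[_ [g gU ->] ->]|d3 tau tauP].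
  apply: (link_vertex_iso t0 soc (chart_eq gU) _ (vertex_star r_gt0 d_gt1 gU)).
  by move=> k _; exact: chart0.
(* A cell of dimension [d - 3] has [d - 2 > 0] vertices; any of them can be the base point of the
   chart. *)
have [C tauC] : exists C, tau C.
  apply: contrapT => none; have [_ c] := tauP.
  have tau0 : tau = set0 by apply/seteqP; split=> // x tx; case: none; exists x.
  move: c; rewrite tau0 => /card_esym; rewrite card_eq0 => /eqP c.
  by have : set0 0%N by rewrite -c.
have : vertices (geodesic_power V m.+1 r) C.
  by case: tauP => tauX _; apply: cells_sub tauX => _ ->.
move=> /geodesic_power_vertex[_ [g gU ->] CE]; rewrite CE in tauC.
apply: (link_codim2 t0 soc (chart_eq gU) _ (vertex_star r_gt0 d_gt1 gU) d3 tauC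
  tauP).
by move=> k _; exact: chart0.
Qed.
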